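(* Let $\mathfrak{g}$ be a $6$-dimensional strongly unimodular almost nilpotent real Lie algebra with nilradical $\mathfrak{n}$ satisfying $\dim\mathfrak{n}^1=1$, where $\mathfrak{n}^1=[\mathfrak{n},\mathfrak{n}]$. Then $\mathfrak{g}$ admits SKT structures $(J,g)$ satisfying $J\mathfrak{n}^1\subset\mathfrak{n}$ if and only if it is isomorphic to one of the following: - $\mathfrak{s}_{4.6}\oplus\mathbb{R}^2=(f^{23},f^{26},-f^{36},0,0,0)$, - $\mathfrak{s}_{4.7}\oplus\mathbb{R}^2=(f^{23},f^{36},-f^{26},0,0,0)$, - $\mathfrak{s}_{6.25}=(f^{23},f^{36},-f^{26},0,f^{46},0)$, - $\mathfrak{s}_{6.51}^{a,0}=(f^{23},af^{26},-af^{36},f^{56},-f^{46},0)$, $a>0$, - $\mathfrak{s}_{6.158}=(f^{24}+f^{35},0,f^{36},0,-f^{56},0)$, - $\mathfrak{s}_{6.164}^a=(f^{24}+f^{35},af^{26},f^{56},-af^{46},-f^{36},0)$, $a>0$. Explicit examples of such SKT structures on these Lie algebras are provided by the following complex structures: $Jf_1=f_2$, $Jf_3=f_6$, $Jf_4=f_5$ on $\mathfrak{s}_{4.6}\oplus\mathbb{R}^2$; $Jf_1=f_4$, $Jf_2=f_3$, $Jf_5=f_6$ on $\mathfrak{s}_{4.7}\oplus\mathbb{R}^2$; $Jf_1=-f_5$, $Jf_2=f_3$, $Jf_4=f_6$ on $\mathfrak{s}_{6.25}$; $Jf_1=af_2$, $Jf_3=f_6$, $Jf_4=f_5$ on $\mathfrak{s}_{6.51}^{a,0}$;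 $Jf_1=f_3$, $Jf_2=f_4$, $Jf_5=f_6$ on $\mathfrak{s}_{6.158}$; $Jf_1=af_2$, $Jf_3=f_5$, $Jf_4=f_6$ on $\mathfrak{s}_{6.164}^a$; together with the metric for which the basis $\{f_1,\dots,f_6\}$ is orthonormal.
   Context: The nilradical $\mathfrak{n}$ of a solvable Lie algebra $\mathfrak{g}$ is its maximal nilpotent ideal; $\mathfrak{g}$ is almost nilpotent if it is solvable and $\mathfrak{n}$ has codimension one. With $\mathfrak{n}^0=\mathfrak{n}$, $\mathfrak{n}^{l}=[\mathfrak{n},\mathfrak{n}^{l-1}]$, a solvable $\mathfrak{g}$ is strongly unimodular if $\operatorname{tr}(\mathrm{ad}_X|_{\mathfrak{n}^l/\mathfrak{n}^{l+1}})=0$ for all $X\in\mathfrak{g}$, $l\in\mathbb{N}$. A Hermitian structure $(J,g)$ on $\mathfrak{g}$ is an integrable complex structure $J$ (vanishing Nijenhuis tensor) together with a positive definite $J$-orthogonal inner product $g$; $\omega=g(J\cdot,\cdot)$. It is SKT if $dd^c\omega=0$, with $d$ the Chevalley–Eilenberg differential and $d^c=i(\overline\partial-\partial)$. $(\phi_1,\dots,\phi_6)$ denotes the Lie algebra with basis $\{f_k\}$ whose dual basis satisfies $df^k=\phi_k$, where $f^{kl}=f^k\wedge f^l$ and $d\alpha(X,Y)=-\alpha([X,Y])$.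
   Formalization: On s_{6.51}^{a,0} and s_{6.164}^a the example metric is the one making {f_1, a f_2, f_3, ..., f_6} orthonormal, since for a ≠ 1 the metric with {f_1,...,f_6} orthonormal is not J-orthogonal (|J f_1| = a, |f_1| = 1); the two agree at a = 1. *)

(* Defs.v *)
From HB Require Import structures.
From mathcomp Require Import all_boot all_order all_algebra.
From mathcomp Require Import reals complex.
From mathcomp Require Import ring.

Set Implicit Arguments.
Unset Strict Implicit.
Unset Printing Implicit Defensive.

Import Order.TTheory GRing.Theory Num.Theory.
Local Open Scope ring_scope.

Structure lieAlgebra (R : realType) := LieAlgebra {
  lie_sort :> vectType R;
  bracket : lie_sort -> lie_sort -> lie_sort;
  bracket_linearr : forall x, linear (bracket x);
  bracket_linearl : forall y, linear (bracket^~ y);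
  bracketxx : forall x, bracket x x = 0;
  bracket_jacobi : forall x y z,
    bracket x (bracket y z) + bracket y (bracket z x)
      + bracket z (bracket x y) = 0
}.

Section LieTheory.
Variables (R : realType) (g : lieAlgebra R).
Local Notation "[ 'lie' x , y ]" := (@bracket R g x y)
  (at level 0, x, y at level 99).
Implicit Types (U V W n m : {vspace g}) (x y : g).

(* [U, V] is the span of all brackets; bases suffice by bilinearity, see
   [lie_prod_subP]. *)
Definition lie_prod U V : {vspace g} :=
  <<[seq [lie x, y] | x <- vbasis U, y <- vbasis V]>>%VS.

Lemma lie_prod_subP U V W :
  reflect (forall x y, x \in U -> y \in V -> [lie x, y] \in W)
          (lie_prod U V <= W)%VS.
Proof.
have sumr x I (r : seq I) F :
    [lie x, \sum_(i <- r) F i] = \sum_(i <- r) [lie x, F i].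
  pose h := GRing.isLinear.Build _ _ _ _ (bracket x) (bracket_linearr x).
  pose H : {linear g -> g} := HB.pack (@bracket R g x) h.
  exact: (raddf_sum H).
have suml y I (r : seq I) F :
    [lie \sum_(i <- r) F i, y] = \sum_(i <- r) [lie F i, y].
  pose h := GRing.isLinear.Build _ _ _ _ ((@bracket R g)^~ y)
    (bracket_linearl y).
  pose H : {linear g -> g} := HB.pack ((@bracket R g)^~ y) h.
  exact: (raddf_sum H).
have zr c x y : [lie x, c *: y] = c *: [lie x, y].
  have b0 : [lie x, 0] = 0 by have := sumr x 'I_0 [::] (fun=> 0); rewrite !big_nil.
  by have := bracket_linearr x c y 0; rewrite !addr0 b0 addr0.
have zl c x y : [lie c *: x, y] = c *: [lie x, y].
  have b0 : [lie 0, y] = 0 by have := suml y 'I_0 [::] (fun=> 0); rewrite !big_nil.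
  by have := bracket_linearl y c x 0; rewrite /= !addr0 b0 addr0.
apply: (iffP idP) => [sW x y Ux Vy | H]; last first.
  apply/span_subvP => z /allpairsP[[x y] /= [Ux Vy ->]].
  by apply: H; apply: vbasis_mem.
apply: (subvP sW).
rewrite (coord_vbasis Ux) (coord_vbasis Vy) suml memv_suml // => i _.
rewrite sumr memv_suml // => j _; rewrite zl zr !memvZ // memv_span //.
by apply: allpairs_f; apply: mem_nth; rewrite size_tuple.
Qed.

(* n^l, with n^0 = n and n^(l+1) = [n, n^l]; so [lcs n 1] is [n, n] *)
Definition lcs n (l : nat) : {vspace g} := iter l (lie_prod n) n.

Definition derived_series (l : nat) : {vspace g} :=
  iter l (fun U => lie_prod U U) fullv.

Definition solvable_lie : Prop := exists l, derived_series l = 0%VS.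

Definition nilpotent_sub n : Prop := exists l, lcs n l = 0%VS.

Definition is_ideal n : Prop := (lie_prod fullv n <= n)%VS.

Definition is_nilradical n : Prop :=
  [/\ is_ideal n, nilpotent_sub n
    & forall m, is_ideal m -> nilpotent_sub m -> (m <= n)%VS].

Definition almost_nilpotent : Prop :=
  solvable_lie /\ exists2 n, is_nilradical n & \dim {: g} = (\dim n).+1.

(* Trace of the endomorphism of U / W induced by f, for W <= U both stable
   under f. The classes mod W of the basis [vbasis (U :\: W)] of a complement
   of W in U form a basis of U / W; the summands are the diagonal entries of
   the matrix of the induced map in that basis. *)
Definition quo_trace (f : g -> g) U W : R :=
  \sum_(i < \dim (U :\: W))
     coord (vbasis (U :\: W)) i
       (daddv_pi (U :\: W) W (f (vbasis (U :\: W))`_i)).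

Definition strongly_unimodular : Prop :=
  solvable_lie /\
  exists2 n, is_nilradical n &
    forall (x : g) (l : nat),
      quo_trace (bracket x) (lcs n l) (lcs n l.+1) = 0.

Implicit Types (J : 'End(g)) (met : g -> g -> R).

Definition nijenhuis J x y : g :=
  [lie J x, J y] - J [lie J x, y] - J [lie x, J y] - [lie x, y].

Definition is_complex_structure J : Prop :=
  (forall x, J (J x) = - x) /\ (forall x y, nijenhuis J x y = 0).

Definition is_inner_product met : Prop :=
  [/\ forall x, linear (met x : g -> R^o),
      forall x y, met x y = met y x
    & forall x, x != 0 -> 0 < met x x].

Definition is_hermitian J met : Prop :=
  [/\ is_complex_structure J, is_inner_product met
    & forall x y, met (J x) (J y) = met x y].

(* Complex-valued k-forms on g (elements of the k-th exterior power of
   g^* (x) C), seen as functions of k real vectors. Multilinearity and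
   alternation are not bundled: all operators below are only applied to the
   fundamental form. *)
Definition cform (k : nat) : Type := {ffun 'I_k -> g} -> R[i].

Definition fcons k x (X : {ffun 'I_k -> g}) : {ffun 'I_k.+1 -> g} :=
  [ffun l => oapp X x (unlift ord0 l)].

(* Chevalley-Eilenberg differential:
     (d a)(X_0, .., X_(k+1)) = \sum_(i < j) (-1)^(i+j)
        a([X_i, X_j], X_0, .., (no X_i), .., (no X_j), .., X_(k+1)).
   For i < j, [lift j i] is i, and [lift j \o lift i] enumerates the indices
   other than i and j in increasing order. *)
Definition ce_d k (a : cform k.+1) : cform k.+2 := fun X =>
  \sum_(j < k.+2) \sum_(i < k.+1 | (i < j)%N)
    (-1) ^+ (i + j) *
    a (fcons [lie X (lift j i), X j] [ffun l => X (lift j (lift i l))]).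

(* The pair (u, v) stands for the element u + i v of the complexification;
   [cext a] is the complex multilinear extension of a. *)
Definition cext k (a : cform k) (Z : 'I_k -> g * g) : R[i] :=
  \sum_(T : {set 'I_k})
     'i%C ^+ #|T| * a [ffun l => if l \in T then (Z l).2 else (Z l).1].

(* (x - i J x) / 2 and (x + i J x) / 2, the components of x in the +i and -i
   eigenspaces of J *)
Definition part10 J x : g * g := (2^-1 *: x, - (2^-1 *: J x)).
Definition part01 J x : g * g := (2^-1 *: x, 2^-1 *: J x).

(* component of type (p, k - p) of the k-form a *)
Definition type_part J k (p : nat) (a : cform k) : cform k := fun X =>
  \sum_(S : {set 'I_k} | #|S| == p)
     cext a (fun l => if l \in S then part10 J (X l) else part01 J (X l)).

Definition ce_del J k (a : cform k.+1) : cform k.+2 := fun X =>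
  \sum_(p < k.+2) type_part J p.+1 (ce_d (type_part J p a)) X.

Definition ce_delbar J k (a : cform k.+1) : cform k.+2 := fun X =>
  \sum_(p < k.+2) type_part J p (ce_d (type_part J p a)) X.

Definition ce_dc J k (a : cform k.+1) : cform k.+2 := fun X =>
  'i%C * (ce_delbar J a X - ce_del J a X).

Definition fundamental_form J met : cform 2 := fun X =>
  (met (J (X ord0)) (X ord_max))%:C%C.

Definition is_SKT J met : Prop :=
  is_hermitian J met /\
  forall X, ce_d (ce_dc J (fundamental_form J met)) X = 0.

Definition orthonormal_seq met (e : seq g) : Prop :=
  forall i j : 'I_(size e), met e`_i e`_j = (i == j)%:R.

Definition is_SKT_adapted J met : Prop :=
  is_SKT J met /\
  exists2 n, is_nilradical n & (J @: lcs n 1 <= n)%VS.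

End LieTheory.

Definition lie_isomorphic (R : realType) (g h : lieAlgebra R) : Prop :=
  exists2 phi : {linear g -> h}, bijective phi
    & {morph phi : x y / bracket x y}.

(* Lie algebras given by structure equations (phi_1, .., phi_6): the carrier
   is 'rV[R]_6 with its canonical basis f_1, .., f_6 and dual basis f^k; a
   2-form w is represented by the matrix with w(x, y) = x *m w *m y^T. *)
Section StructureEquations.
Variable R : realType.
Implicit Types (phi : seq 'M[R]_6) (x y z : 'rV[R]_6) (a : R).

(* indices are shifted: k ranges over 1, .., 6 *)
Definition ix (k : nat) : 'I_6 := inord k.-1.

Definition fb (k : nat) : 'rV[R]_6 := delta_mx 0 (ix k).

(* f^k /\ f^l *)
Definition fw (k l : nat) : 'M[R]_6 :=
  delta_mx (ix k) (ix l) - delta_mx (ix l) (ix k).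

Definition form2 (w : 'M[R]_6) x y : R := (x *m w *m y^T) 0 0.

(* d f^k = phi_k, with (d f^k)(x, y) = - f^k([x, y]) *)
Definition str_bracket phi x y : 'rV[R]_6 :=
  \row_(k < 6) - form2 phi`_k x y.

Lemma form2_linearr w x : linear (form2 w x : 'rV[R]_6 -> R^o).
Proof.
by move=> c y z; rewrite /form2 linearD linearZ /= mulmxDr -scalemxAr !mxE.
Qed.

Lemma form2_linearl w y : linear (form2 w ^~ y : 'rV[R]_6 -> R^o).
Proof.
by move=> c x z; rewrite /form2 !mulmxDl -!scalemxAl !mxE.
Qed.

Lemma str_bracket_linearr phi x : linear (str_bracket phi x).
Proof.
by move=> c y z; apply/rowP => k; rewrite !mxE form2_linearr opprD mulrN.
Qed.

Lemma str_bracket_linearl phi y : linear (str_bracket phi ^~ y).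
Proof.
by move=> c x z; apply/rowP => k; rewrite !mxE form2_linearl opprD mulrN.
Qed.

Lemma form2_fw k l x y :
  form2 (fw k l) x y = x 0 (ix k) * y 0 (ix l) - x 0 (ix l) * y 0 (ix k).
Proof.
have form2_delta i j : (x *m delta_mx i j *m y^T) 0 0 = x 0 i * y 0 j.
  rewrite mxE (bigD1 j) //= big1 ?addr0 => [|s neq]; last first.
    rewrite mxE big1 ?mul0r // => t _.
    by rewrite !mxE (negPf neq) andbF mulr0.
  rewrite !mxE (bigD1 i) //= big1 ?addr0 => [|t neq].
    by rewrite !mxE !eqxx mulr1.
  by rewrite !mxE (negPf neq) mulr0.
by rewrite /form2 /fw mulmxBr mulmxBl mxE [X in _ + X]mxE !form2_delta.
Qed.

Lemma form2D v w x y : form2 (v + w) x y = form2 v x y + form2 w x y.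
Proof. by rewrite /form2 mulmxDr mulmxDl mxE. Qed.

Lemma form2N w x y : form2 (- w) x y = - form2 w x y.
Proof. by rewrite /form2 mulmxN mulNmx mxE. Qed.

Lemma form2Z a w x y : form2 (a *: w) x y = a * form2 w x y.
Proof. by rewrite /form2 -scalemxAr -scalemxAl mxE. Qed.

Lemma form20 x y : form2 0 x y = 0.
Proof. by rewrite /form2 mulmx0 mul0mx mxE. Qed.

Definition form2E := (form2D, form2N, form2Z, form20, form2_fw).

Lemma ix_inj k l : (0 < k <= 6)%N -> (0 < l <= 6)%N -> (ix k == ix l) = (k == l).
Proof.
by case: k l => [|k] [|l] // /andP[_ ?] /andP[_ ?]; rewrite -val_eqE /= !inordK.
Qed.

Lemma str_bracketE phi x y k : (0 < k <= 6)%N ->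
  str_bracket phi x y 0 (ix k) = - form2 phi`_k.-1 x y.
Proof. by case: k => [|k] // /andP[_ ?]; rewrite mxE /= inordK. Qed.

Lemma row6P x y :
  x 0 (ix 1) = y 0 (ix 1) -> x 0 (ix 2) = y 0 (ix 2) ->
  x 0 (ix 3) = y 0 (ix 3) -> x 0 (ix 4) = y 0 (ix 4) ->
  x 0 (ix 5) = y 0 (ix 5) -> x 0 (ix 6) = y 0 (ix 6) -> x = y.
Proof.
move=> e1 e2 e3 e4 e5 e6; apply/rowP => k.
have -> : k = ix k.+1 by rewrite /ix /= inord_val.
by case: k => -[|[|[|[|[|[|k]]]]]] //= lt_k.
Qed.

Let rowD x y k : (x + y) 0 k = x 0 k + y 0 k. Proof. by rewrite mxE. Qed.
Let row0 k : (0 : 'rV[R]_6) 0 k = 0. Proof. by rewrite mxE. Qed.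

Ltac str_law :=
  intros; apply: row6P;
  rewrite ?rowD row0 !str_bracketE //= ?form2E ?str_bracketE //= ?form2E; ring.

Definition phi_4_6 : seq 'M[R]_6 := [:: fw 2 3; fw 2 6; - fw 3 6; 0; 0; 0].
Definition phi_4_7 : seq 'M[R]_6 := [:: fw 2 3; fw 3 6; - fw 2 6; 0; 0; 0].
Definition phi_6_25 : seq 'M[R]_6 :=
  [:: fw 2 3; fw 3 6; - fw 2 6; 0; fw 4 6; 0].
Definition phi_6_51 a : seq 'M[R]_6 :=
  [:: fw 2 3; a *: fw 2 6; - (a *: fw 3 6); fw 5 6; - fw 4 6; 0].
Definition phi_6_158 : seq 'M[R]_6 :=
  [:: fw 2 4 + fw 3 5; 0; fw 3 6; 0; - fw 5 6; 0].
Definition phi_6_164 a : seq 'M[R]_6 :=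
  [:: fw 2 4 + fw 3 5; a *: fw 2 6; fw 5 6; - (a *: fw 4 6); - fw 3 6; 0].

Definition str_lie_laws phi : Prop :=
  (forall x, str_bracket phi x x = 0) /\
  (forall x y z,
    str_bracket phi x (str_bracket phi y z)
      + str_bracket phi y (str_bracket phi z x)
      + str_bracket phi z (str_bracket phi x y) = 0).

Definition str_lie phi (H : str_lie_laws phi) : lieAlgebra R :=
  @LieAlgebra R 'rV[R]_6 (str_bracket phi) (str_bracket_linearr phi)
    (str_bracket_linearl phi) H.1 H.2.

Lemma laws_4_6 : str_lie_laws phi_4_6. Proof. by split; str_law. Qed.
Lemma laws_4_7 : str_lie_laws phi_4_7. Proof. by split; str_law. Qed.
Lemma laws_6_25 : str_lie_laws phi_6_25. Proof. by split; str_law. Qed.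
Lemma laws_6_51 a : str_lie_laws (phi_6_51 a). Proof. by split; str_law. Qed.
Lemma laws_6_158 : str_lie_laws phi_6_158. Proof. by split; str_law. Qed.
Lemma laws_6_164 a : str_lie_laws (phi_6_164 a). Proof. by split; str_law. Qed.

(* [s4_6_R2], [s4_7_R2]: direct sums of the 4-dimensional algebra with R^2 *)
Definition s4_6_R2 : lieAlgebra R := str_lie laws_4_6.
Definition s4_7_R2 : lieAlgebra R := str_lie laws_4_7.
Definition s6_25 : lieAlgebra R := str_lie laws_6_25.
(* second parameter of the family equal to 0 *)
Definition s6_51 a : lieAlgebra R := str_lie (laws_6_51 a).
Definition s6_158 : lieAlgebra R := str_lie laws_6_158.
Definition s6_164 a : lieAlgebra R := str_lie (laws_6_164 a).

End StructureEquations.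

(* Main.v *)
Require Import Defs.
From HB Require Import structures.
From mathcomp Require Import all_boot all_order all_algebra.
From mathcomp Require Import reals complex.
From mathcomp Require Import ring lra.

(* Integrability turns dd^c omega into the differential of the torsion 3-form
   T(x, y, z) = <[Jx, Jy], z> + cyclic permutations, so that SKT becomes a real
   polynomial condition on the structure constants.

   For the classification, take a unitary basis with e1 spanning [n, n],
   e2 = J e1, e4 = J e3, e6 = J e5 orthogonal to n. Then e1 is central, by
   nilpotency of n and unimodularity, and integrability leaves
     [e3, e4] = c e1, [e5, ei] = xi e1 (i = 2, 3, 4) and, for D = ad e6,
     D e2 = x2 e2, D e3 = a1 e1 + a2 e2 + p e3 + q e4,
     D e4 = (x3 - a2) e1 + (x4 + a1) e2 - q e3 + p e4,
     D e5 = v1 e1 + v2 e2 + v3 e3 + v4 e4 + m e5.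
   Jacobi, tr D = 0 and the fact that g is not nilpotent (its nilradical is
   proper) give p = 0, m = - x2 and (x2, q) != (0, 0). The SKT condition then
   forces a1 = - x4, a2 = 0 and c v1 = - (x3^2 + x4^2), which is what excludes
   the algebras missing from the list. The six algebras correspond to which of
   c, x2, q and v2 vanish. *)

Set Implicit Arguments.
Unset Strict Implicit.
Unset Printing Implicit Defensive.

Import Order.TTheory GRing.Theory Num.Theory.
Local Open Scope ring_scope.

(** The metric makes omega of type (1,1) and integrability makes d omega of type (2,1) + (1,2);
    hence d^c omega = - d omega(J, J, J), which is T because the metric is J-invariant. The
    inclusion of J n^1 in n is what makes the unitary basis possible: it puts e2 in n, so that the
    complex lines through e1 and through the normal e6 are orthogonal. As n^1 is a line and [n, n^1]
    = 0, strong unimodularity amounts to two trace conditions, on n^1 and on n/n^1. After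
    integrability, the decisive equations come in pairs that are single complex equations (a + i
    b)(r + i s) = 0. One factor is nonzero, because n^1 is nonzero or because g is not nilpotent, so
    the other vanishes. For the converse the structures on the models are pulled back. The
    nilradical of a model is the hyperplane f^6 = 0; its maximality holds because ad x is not
    nilpotent for x outside of it. *)

Section Bracket.
Variables (R : realType) (g : lieAlgebra R).
Implicit Types (x y z : g) (c : R).

HB.instance Definition _ x :=
  GRing.isLinear.Build R g g *:%R (@bracket R g x) (bracket_linearr x).

Lemma bracketDl x y z : bracket (x + y) z = bracket x z + bracket y z.
Proof. by have := bracket_linearl z 1 x y; rewrite !scale1r. Qed.

Lemma bracket0l y : bracket 0 y = 0.
Proof. by apply: (addrI (bracket 0 y)); rewrite -bracketDl !addr0. Qed.

Lemma bracketZl c x y : bracket (c *: x) y = c *: bracket x y.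
Proof. by have := bracket_linearl y c x 0; rewrite bracket0l !addr0. Qed.

Lemma bracketC x y : bracket y x = - bracket x y.
Proof.
apply/eqP; rewrite -addr_eq0; apply/eqP.
have := bracketxx (x + y).
by rewrite bracketDl !linearD /= !bracketxx add0r addr0 addrC.
Qed.

End Bracket.

(** * The operator dd^c on omega and the torsion 3-form *)

Section TorsionDef.
Variables (R : realType) (V : Type).
Variables (br : V -> V -> V) (J : V -> V) (met : V -> V -> R).

(** This is d^c omega. It and its Chevalley-Eilenberg differential [dtorsion] take bare functions,
    so that the same expressions apply to a Lie algebra and to a bracket on coordinate rows. *)
Definition torsion x y z : R :=
  met (br (J x) (J y)) z + met (br (J y) (J z)) x + met (br (J z) (J x)) y.

Definition dtorsion x y z w : R :=
  - torsion (br x y) z w + torsion (br x z) y w - torsion (br x w) y z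
  - torsion (br y z) x w + torsion (br y w) x z - torsion (br z w) x y.

End TorsionDef.

Section SubsetSums.
Variable V : nmodType.

(** Subsets are indexed by their indicator vectors, which turns the sums over subsets in [cext] and
    [type_part] into explicit finite sums. *)
Lemma sum_set2 (F : {set 'I_2} -> V) :
  \sum_(T : {set 'I_2}) F T =
  \sum_(b : bool * bool) F [set i : 'I_2 | nth false [:: b.1; b.2] i].
Proof.
rewrite (reindex (fun b : bool * bool => [set i : 'I_2 | nth false [:: b.1; b.2] i])) //.
exists (fun T : {set 'I_2} => (ord0 \in T, ord_max \in T)).
  by move=> -[b1 b2] _; rewrite !inE.
move=> T _; apply/setP => i; rewrite !inE.
by case: i => -[|[|i]] //= Hi; congr (_ \in T); apply: val_inj.
Qed.

Lemma sum_set3 (F : {set 'I_3} -> V) :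
  \sum_(T : {set 'I_3}) F T =
  \sum_(b : bool * bool * bool)
    F [set i : 'I_3 | nth false [:: b.1.1; b.1.2; b.2] i].
Proof.
rewrite (reindex (fun b : bool * bool * bool =>
  [set i : 'I_3 | nth false [:: b.1.1; b.1.2; b.2] i])) //.
exists (fun T : {set 'I_3} => (ord0 \in T, lift ord0 ord0 \in T, ord_max \in T)).
  by move=> -[[b1 b2] b3] _; rewrite !inE.
move=> T _; apply/setP => i; rewrite !inE.
by case: i => -[|[|[|i]]] //= Hi; congr (_ \in T); apply: val_inj.
Qed.

Lemma sum_pairs (F : bool * bool -> V) :
  \sum_b F b = F (true, true) + F (true, false) + F (false, true) + F (false, false).
Proof.
rewrite (eq_bigr (fun b => F (b.1, b.2))); last by case.
by rewrite -(pair_bigA _ (fun a b => F (a, b))) /= !big_bool /= !addrA.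
Qed.

Lemma sum_triples (F : bool * bool * bool -> V) :
  \sum_b F b = F (true, true, true) + F (true, true, false)
   + F (true, false, true) + F (true, false, false)
   + F (false, true, true) + F (false, true, false)
   + F (false, false, true) + F (false, false, false).
Proof.
rewrite (eq_bigr (fun b => F (b.1, b.2))); last by case.
by rewrite -(pair_bigA _ (fun a b => F (a, b))) /= sum_pairs !big_bool /= !addrA.
Qed.

End SubsetSums.

Section TypeParts.
Variables (R : realType) (g : lieAlgebra R).

Let i0 : 'I_3 := ord0.
Let i1 : 'I_3 := lift ord0 ord0.
Let i2 : 'I_3 := ord_max.

Lemma card_bits2 b1 b2 :
  #|[set i : 'I_2 | nth false [:: b1; b2] i]| = (b1 + b2)%N.
Proof.
rewrite -sum1_card big_mkcond /= !big_ord_recl big_ord0 !inE /=.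
by case: b1 b2 => -[].
Qed.

Lemma card_bits3 b1 b2 b3 :
  #|[set i : 'I_3 | nth false [:: b1; b2; b3] i]| = (b1 + b2 + b3)%N.
Proof.
rewrite -sum1_card big_mkcond /= !big_ord_recl big_ord0 !inE /=.
by case: b1 b2 b3 => -[] -[].
Qed.

(** For a real form the complex extension is split into real and imaginary parts, so that later
    identities are polynomial identities over [R]. *)
Lemma cext2 (a : cform g 2) (A : g -> g -> R) Z :
    (forall X, a X = (A (X ord0) (X ord_max))%:C%C) ->
  cext a Z = ((A (Z ord0).1 (Z ord_max).1 - A (Z ord0).2 (Z ord_max).2)
     +i* (A (Z ord0).1 (Z ord_max).2 + A (Z ord0).2 (Z ord_max).1))%C.
Proof.
move=> aE; rewrite /cext sum_set2 sum_pairs !card_bits2 !aE !ffunE !inE /=.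
rewrite !exprS !expr0.
by apply/eqP; rewrite eq_complex /=; apply/andP; split; apply/eqP; ring.
Qed.

Lemma cext3 (a : cform g 3) (A : g -> g -> g -> R) Z :
    (forall X, a X = (A (X i0) (X i1) (X i2))%:C%C) ->
  cext a Z = ((A (Z i0).1 (Z i1).1 (Z i2).1 - A (Z i0).1 (Z i1).2 (Z i2).2
      - A (Z i0).2 (Z i1).1 (Z i2).2 - A (Z i0).2 (Z i1).2 (Z i2).1)
     +i* (A (Z i0).1 (Z i1).1 (Z i2).2 + A (Z i0).1 (Z i1).2 (Z i2).1
       + A (Z i0).2 (Z i1).1 (Z i2).1 - A (Z i0).2 (Z i1).2 (Z i2).2))%C.
Proof.
move=> aE; rewrite /cext sum_set3 sum_triples !card_bits3 !aE !ffunE !inE /=.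
rewrite !exprS !expr0.
by apply/eqP; rewrite eq_complex /=; apply/andP; split; apply/eqP; ring.
Qed.

Lemma fcons0 k x (X : {ffun 'I_k -> g}) : fcons x X ord0 = x.
Proof. by rewrite ffunE unlift_none. Qed.

Lemma fcons_lift k x (X : {ffun 'I_k -> g}) l : fcons x X (lift ord0 l) = X l.
Proof. by rewrite ffunE liftK. Qed.

Lemma fcons_max k x (X : {ffun 'I_k.+1 -> g}) : fcons x X ord_max = X ord_max.
Proof. by rewrite -[RHS](fcons_lift x); congr (fcons _ _ _); apply: val_inj. Qed.

Lemma ce_d2 (a : cform g 2) (A : g -> g -> R) X :
    (forall X, a X = (A (X ord0) (X ord_max))%:C%C) ->
  ce_d a X = (- A (bracket (X i0) (X i1)) (X i2)
    + A (bracket (X i0) (X i2)) (X i1) - A (bracket (X i1) (X i2)) (X i0))%:C%C.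
Proof.
move=> aE; rewrite /ce_d.
under eq_bigr => j _ do rewrite big_mkcond.
rewrite !big_ord_recl !big_ord0 /= !aE !fcons0 !fcons_max !ffunE.
(* Different composites of [lift] denote the same index; through [inord] they become the same
   numeral. *)
have Xv i : X i = X (inord i) by rewrite inord_val.
do ![rewrite [X (lift _ _)]Xv]; rewrite [X ord0]Xv [X ord_max]Xv /= /bump /=.
rewrite !exprS !expr0.
by apply/eqP; rewrite eq_complex /=; apply/andP; split; apply/eqP; ring.
Qed.

Lemma ce_d3 (a : cform g 3) (A : g -> g -> g -> R) (X : {ffun 'I_4 -> g}) :
    (forall X, a X = (A (X i0) (X i1) (X i2))%:C%C) ->
  let x := X ord0 in let y := X (lift ord0 ord0) in
  let z := X (lift ord0 (lift ord0 ord0)) in let w := X ord_max in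
  ce_d a X = (- A (bracket x y) z w + A (bracket x z) y w - A (bracket x w) y z
    - A (bracket y z) x w + A (bracket y w) x z - A (bracket z w) x y)%:C%C.
Proof.
move=> aE x y z w; rewrite /ce_d.
under eq_bigr => j _ do rewrite big_mkcond.
rewrite !big_ord_recl !big_ord0 /= !aE !fcons0 !fcons_max !fcons_lift !ffunE.
rewrite {}/x {}/y {}/z {}/w.
have Xv i : X i = X (inord i) by rewrite inord_val.
do ![rewrite [X (lift _ _)]Xv]; rewrite [X ord0]Xv [X ord_max]Xv /= /bump /=.
rewrite !exprS !expr0.
by apply/eqP; rewrite eq_complex /=; apply/andP; split; apply/eqP; ring.
Qed.

End TypeParts.

Section SKT.
Variables (R : realType) (g : lieAlgebra R) (J : 'End(g)) (met : g -> g -> R).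
Hypothesis met_inner : is_inner_product met.

Let metr x : linear (met x : g -> R^o). Proof. by case: met_inner. Qed.

Lemma metC x y : met x y = met y x. Proof. by case: met_inner. Qed.

Lemma metDr x y z : met x (y + z) = met x y + met x z.
Proof. by have := metr x 1 y z; rewrite !scale1r. Qed.

Lemma met0r x : met x 0 = 0.
Proof. by apply: (addrI (met x 0)); rewrite -metDr !addr0. Qed.

Lemma metZr x a y : met x (a *: y) = a * met x y.
Proof. by have := metr x a y 0; rewrite met0r !addr0. Qed.

Lemma metNr x y : met x (- y) = - met x y.
Proof. by rewrite -scaleN1r metZr mulN1r. Qed.

Lemma metDl x y z : met (x + y) z = met x z + met y z.
Proof. by rewrite metC metDr !(metC z). Qed.

Lemma metZl x a y : met (a *: x) y = a * met x y.
Proof. by rewrite metC metZr metC. Qed.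

Lemma metNl x y : met (- x) y = - met x y.
Proof. by rewrite metC metNr metC. Qed.

Hypothesis herm : is_hermitian J met.
Let JJ x : J (J x) = - x. Proof. by case: herm => -[]. Qed.
Let nij x y : nijenhuis J x y = 0. Proof. by case: herm => -[]. Qed.
Let metJ x y : met (J x) (J y) = met x y. Proof. by case: herm. Qed.
Let metJl x y : met (J x) y = - met x (J y).
Proof. by rewrite -[in RHS]metJ JJ metNr opprK. Qed.

Let om x y := met (J x) y.
Let dom x y z := - om (bracket x y) z + om (bracket x z) y - om (bracket y z) x.

(** J is an isometry, so omega is of type (1,1). *)
Lemma type_part_om p X : type_part J p (fundamental_form J met) X =
  if p == 1%N then fundamental_form J met X else 0.
Proof.
have omE Y : fundamental_form J met Y = (om (Y ord0) (Y ord_max))%:C%C by [].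
rewrite /type_part big_mkcond sum_set2 sum_pairs !card_bits2 !(cext2 _ omE) !inE /=.
rewrite /om !linearN !linearZ /= ?JJ !(metZl, metZr, metNl, metNr, scalerN) !metJ.
rewrite omE /om !metJl ?JJ ?metNr.
case: p => [|[|[|p]]] /=.
all: by apply/eqP; rewrite eq_complex /=; apply/andP; split; apply/eqP; field.
Qed.

Lemma ce_dom : forall X, ce_d (fundamental_form J met) X =
  (dom (X ord0) (X (lift ord0 ord0)) (X ord_max))%:C%C.
Proof. by move=> X; rewrite (ce_d2 (A := om)). Qed.

(** This encodes the vanishing of the (3,0) and (0,3) parts of d omega. On type (2,1) both sides act
    as i; on type (3,0) the sum acts as 3i and the triple product as -i; the other types are
    conjugate. The vanishing of the Nijenhuis tensor enters through [N]. *)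
Lemma dom_J x y z :
  dom (J x) y z + dom x (J y) z + dom x y (J z) = dom (J x) (J y) (J z).
Proof.
have N a b c : met (bracket (J a) (J b)) c =
    met (J (bracket (J a) b)) c + met (J (bracket a (J b))) c + met (bracket a b) c.
  have /eqP := nij a b; rewrite /nijenhuis !subr_eq add0r => /eqP->.
  by rewrite !metDl; ring.
rewrite /dom /om !metJ !N.
ring.
Qed.

Lemma dom_torsion x y z :
  torsion (@bracket R g) J met x y z =
  - (dom (J x) y z + dom x (J y) z + dom x y (J z)).
Proof.
by rewrite dom_J /dom /om /torsion !metJ (bracketC (J x) (J z)) metNl; ring.
Qed.

Let domZ a x y z : [/\ dom (a *: x) y z = a * dom x y z,
  dom x (a *: y) z = a * dom x y z & dom x y (a *: z) = a * dom x y z].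
Proof.
rewrite /dom /om; split; rewrite ?bracketZl ?linearZ /= ?linearZ /= ?(metZl, metZr).
all: ring.
Qed.

Let domN x y z : [/\ dom (- x) y z = - dom x y z,
  dom x (- y) z = - dom x y z & dom x y (- z) = - dom x y z].
Proof. by have := domZ (- 1) x y z; rewrite !scaleN1r !mulN1r. Qed.

(** The forms del omega and delbar omega are the (2,1) and (1,2) parts of d omega, on which
    inserting J in one slot and summing acts as i and -i. So i(delbar - del) omega is minus that
    sum, which is T by [dom_torsion]. *)
Lemma ce_dcE : forall X, ce_dc J (fundamental_form J met) X =
  (torsion (@bracket R g) J met (X ord0) (X (lift ord0 ord0)) (X ord_max))%:C%C.
Proof.
move=> X.
(* The type parts of omega are known only pointwise, so they are passed through [ce_d] and then
   through [type_part] by values. *)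
have tp p Y : ce_d (type_part J p (fundamental_form J met)) Y =
    if p == 1%N then ce_d (fundamental_form J met) Y else 0.
  rewrite (ce_d2 (A := fun x y => if p == 1%N then om x y else 0)); last first.
    by move=> Z; rewrite type_part_om; case: eqP.
  by rewrite ce_dom /dom; case: eqP => // _; rewrite !oppr0 !addr0.
have tp' q p Y : type_part J q (ce_d (type_part J p (fundamental_form J met))) Y =
    if p == 1%N then type_part J q (ce_d (fundamental_form J met)) Y else 0.
  rewrite /type_part; case: eqP => [->|/eqP/negPf p1].
    apply: eq_bigr => S _; rewrite /cext; apply: eq_bigr => T _; congr (_ * _).
    by rewrite tp.
  rewrite big1 // => S _; rewrite /cext big1 // => T _.
  by rewrite tp p1 mulr0.
rewrite /ce_dc /ce_delbar /ce_del.
under eq_bigr => p _ do rewrite tp'.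
under [X in _ - X]eq_bigr => p _ do rewrite tp'.
rewrite !big_ord_recl !big_ord0 /= !add0r !addr0.
rewrite /type_part !(big_mkcond (fun S => _ == _)) !sum_set3 !sum_triples !card_bits3 /=.
rewrite !add0r !addr0 !(cext3 _ ce_dom) /= !inE /=.
have domZ1 a x y z : dom (a *: x) y z = a * dom x y z by case: (domZ a x y z).
have domZ2 a x y z : dom x (a *: y) z = a * dom x y z by case: (domZ a x y z).
have domZ3 a x y z : dom x y (a *: z) = a * dom x y z by case: (domZ a x y z).
have domN1 x y z : dom (- x) y z = - dom x y z by case: (domN x y z).
have domN2 x y z : dom x (- y) z = - dom x y z by case: (domN x y z).
have domN3 x y z : dom x y (- z) = - dom x y z by case: (domN x y z).
have DJ := dom_J (X ord0) (X (lift ord0 ord0)) (X ord_max).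
rewrite !(domZ1, domZ2, domZ3, domN1, domN2, domN3) dom_torsion -DJ.
by apply/eqP; rewrite eq_complex /=; apply/andP; split; apply/eqP; field.
Qed.

Lemma ddcE (X : {ffun 'I_4 -> g}) :
  ce_d (ce_dc J (fundamental_form J met)) X =
  (dtorsion (@bracket R g) J met (X ord0) (X (lift ord0 ord0))
     (X (lift ord0 (lift ord0 ord0))) (X ord_max))%:C%C.
Proof. exact: ce_d3 ce_dcE. Qed.

End SKT.

Lemma is_SKTP (R : realType) (g : lieAlgebra R) (J : 'End(g)) (met : g -> g -> R) :
  is_SKT J met <-> is_hermitian J met /\
    forall x y z w, dtorsion (@bracket R g) J met x y z w = 0.
Proof.
split=> [[herm skt]|[herm skt]]; have inner : is_inner_product met by case: herm.
  split=> // x y z w.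
  have := skt [ffun i => nth x [:: x; y; z; w] (val i)].
  by rewrite ddcE // !ffunE /= => /(congr1 (@complex.Re R)).
by split=> // X; rewrite ddcE // skt.
Qed.

(** * Ideals, the lower central series and traces on quotients *)

Section Ideals.
Variables (R : realType) (g : lieAlgebra R).
Implicit Types (U V W m n : {vspace g}) (x y z : g).

Lemma mem_lie_prod U V x y : x \in U -> y \in V -> bracket x y \in lie_prod U V.
Proof. exact: (lie_prod_subP U V _ (subvv _)). Qed.

Lemma lie_prodS U1 U2 V1 V2 :
  (U1 <= U2)%VS -> (V1 <= V2)%VS -> (lie_prod U1 V1 <= lie_prod U2 V2)%VS.
Proof.
move=> /subvP sU /subvP sV; apply/lie_prod_subP => x y Ux Vy.
by rewrite mem_lie_prod ?sU ?sV.
Qed.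

Lemma nilradical_unique n n' : is_nilradical n -> is_nilradical n' -> n = n'.
Proof.
move=> [i1 n1 m1] [i2 n2 m2]; apply/eqP; rewrite eqEsubv.
by rewrite m1 ?m2.
Qed.

Lemma idealP n : is_ideal n -> forall x y, y \in n -> bracket x y \in n.
Proof. by move=> /lie_prod_subP idn x y ny; rewrite idn ?memvf. Qed.

Lemma span_bracket_ind (P : g -> Prop) U V :
  P 0 -> (forall a x y, P x -> P y -> P (a *: x + y)) ->
  (forall x y, x \in U -> y \in V -> P (bracket x y)) ->
  forall z, z \in lie_prod U V -> P z.
Proof.
move=> P0 PD PB z; rewrite /lie_prod.
set s := [seq _ | _ <- _, _ <- _].
rewrite -[s]/(tval (in_tuple s)) => /coord_span ->.
apply: (big_ind P) => // [x y Px Py|i _].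
  by have := PD 1 x y Px Py; rewrite scale1r.
rewrite -[_ *: _]addr0; apply: PD => //.
have /allpairsP[[x y] /= [Ux Vy ->]] : s`_i \in s by rewrite mem_nth.
by apply: PB; apply: vbasis_mem.
Qed.

(** Used contrapositively: if all fourfold brackets vanished, g would be its own nilradical. *)
Lemma nilpotent_of_bracket4 :
  (forall x y z w, bracket x (bracket y (bracket z w)) = 0 :> g) ->
  nilpotent_sub (fullv : {vspace g}).
Proof.
move=> H; exists 3%N; apply/eqP; rewrite -subv0; apply/lie_prod_subP => x y _.
move: y; apply: (span_bracket_ind (P := fun u => bracket x u \in 0%VS)).
- by rewrite linear0 mem0v.
- by move=> a u v Pu Pv; rewrite linearP memvD ?memvZ.
move=> y u _; move: u.
apply: (span_bracket_ind (P := fun u => bracket x (bracket y u) \in 0%VS)).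
- by rewrite !linear0 mem0v.
- by move=> a u v Pu Pv; rewrite !linearP memvD ?memvZ.
by move=> z w _ _; rewrite H mem0v.
Qed.

Lemma lcs_sub n l : is_ideal n -> (lcs n l.+1 <= lcs n l)%VS.
Proof.
move=> idn; elim: l => [|l IHl]; last exact: lie_prodS.
by apply/lie_prod_subP => x y nx ny; apply: idealP.
Qed.

Lemma lcs1_ideal n : is_ideal n -> is_ideal (lcs n 1).
Proof.
move=> idn; apply/lie_prod_subP => x u _; move: u.
apply: (span_bracket_ind (P := fun u => bracket x u \in lcs n 1)).
- by rewrite linear0 mem0v.
- by move=> a u v Pu Pv; rewrite linearP memvD ?memvZ.
move=> y z ny nz.
have /eqP := bracket_jacobi x y z; rewrite -addrA addr_eq0 => /eqP->.
rewrite memvN -[lcs n 1]/(lie_prod n n) memvD // mem_lie_prod //; last exact: idealP.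
by rewrite bracketC memvN idealP.
Qed.

(** If [n, n^1] were nonzero it would fill the line n^1, and the series would be constant and
    nonzero from n^1 on. *)
Lemma lcs2_eq0 n : nilpotent_sub n -> is_ideal n -> \dim (lcs n 1) = 1%N ->
  lcs n 2 = 0%VS.
Proof.
move=> [l nil] idn d1; have sub := lcs_sub 1 idn.
have /eqP := dimvS sub; case: (posnP (\dim (lcs n 2))) => [d0|].
  by move=> _; apply/eqP; rewrite -dimv_eq0 d0.
move=> d2 _; have e2 : lcs n 2 = lcs n 1.
  by apply/eqP; rewrite eqEdim sub d1.
have st k : lcs n k.+1 = lcs n 1.
  by elim: k => // k IHk; rewrite -[in RHS]e2 -[LHS]/(lie_prod n (lcs n k.+1)) IHk.
have : lcs n l.+1 = 0%VS.
  by apply/eqP; rewrite -subv0 -nil lcs_sub.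
by rewrite st => e0; move: d1; rewrite e0 dimv0.
Qed.

(* The diagonal of f modulo W is the same in any two generating families of U
   modulo W with coordinate functions: expand each in the other. *)
Lemma quo_traceE (f : {linear g -> g}) U W k (c : 'I_k -> g)
    (gam : 'I_k -> {linear g -> R^o}) :
  (W <= U)%VS -> (forall x, x \in W -> f x \in W) ->
  (forall x, x \in U -> f x \in U) -> (forall j, c j \in U) ->
  (forall j x, x \in W -> gam j x = 0) ->
  (forall x, x \in U -> x - \sum_j gam j x *: c j \in W) ->
  quo_trace f U W = \sum_j gam j (f (c j)).
Proof.
move=> sWU fW fU cU gW dec; rewrite /quo_trace.
set C := (U :\: W)%VS; set b := vbasis C; set P := daddv_pi C W.
have cap0 : (C :&: W = 0)%VS by apply: capv_diff.
have sum : (C + W = U)%VS by rewrite addv_diff; apply/addv_idPl.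
have PD x : x \in U -> x - P x \in W.
  move=> Ux; have := daddv_pi_add cap0 (w := x); rewrite sum => /(_ Ux).
  by move=> {1}<-; rewrite addrC addKr memv_pi.
have PC x : P x \in C by apply: memv_pi.
have PW x : x \in W -> P x = 0.
  move=> Wx; apply/eqP; rewrite -memv0 -cap0 memv_cap PC /=.
  have := PD x (subvP sWU _ Wx) => /(memvB Wx).
  by rewrite opprB addrC subrK.
have bU i : b`_i \in U.
  have [lt_i|ge_i] := ltnP i (size b); last by rewrite nth_default ?mem0v.
  by apply: (subvP (diffvSl U W)); apply: vbasis_mem; rewrite mem_nth.
have Pfb i : P (f b`_i) = \sum_j gam j b`_i *: P (f (c j)).
  rewrite -[b`_i in LHS](subrK (\sum_j gam j b`_i *: c j)).
  rewrite [f _]linearD [P _]linearD /= PW ?add0r; last by apply: fW; apply: dec.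
  by rewrite !linear_sum; apply: eq_bigr => j _; rewrite !linearZ.
transitivity (\sum_(i < \dim C) \sum_j gam j b`_i * coord b i (P (f (c j)))).
  by apply: eq_bigr => i _; rewrite Pfb linear_sum; apply: eq_bigr => j _; rewrite linearZ.
rewrite exchange_big; apply: eq_bigr => j _ /=.
have {2}-> : f (c j) = P (f (c j)) + (f (c j) - P (f (c j))) by rewrite addrC subrK.
rewrite linearD (gW _ _ (PD _ _)) ?fU // addr0.
rewrite [P _ in RHS](coord_vbasis (PC _)) linear_sum.
by apply: eq_bigr => i _; rewrite linearZ /= mulrC.
Qed.

End Ideals.

(** * Transport of nilradicals and SKT structures along isomorphisms *)

Section Transport.
Variables (R : realType) (g h : lieAlgebra R) (f : 'Hom(g, h)).
Hypothesis fM : {morph f : x y / bracket x y}.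

Lemma limg_lie_prod U V : (f @: lie_prod U V = lie_prod (f @: U) (f @: V))%VS.
Proof.
apply/eqP; rewrite eqEsubv; apply/andP; split.
  apply/subvP => _ /memv_imgP[u Uu ->]; move: u Uu.
  apply: span_bracket_ind => [|a x y Px Py|x y Ux Vy].
  - by rewrite linear0 mem0v.
  - by rewrite linearP memvD ?memvZ.
  by rewrite fM mem_lie_prod ?memv_img.
apply/lie_prod_subP => _ _ /memv_imgP[x Ux ->] /memv_imgP[y Vy ->].
by rewrite -fM memv_img ?mem_lie_prod.
Qed.

Lemma limg_lcs n l : (f @: lcs n l = lcs (f @: n) l)%VS.
Proof. by elim: l => //= l <-; rewrite limg_lie_prod. Qed.

Lemma nilpotent_limg n : nilpotent_sub n -> nilpotent_sub (f @: n)%VS.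
Proof. by case=> l nl; exists l; rewrite -limg_lcs nl limg0. Qed.

Lemma ideal_limg n : limg f = fullv -> is_ideal n -> is_ideal (f @: n)%VS.
Proof. by move=> sf idn; rewrite /is_ideal -[X in lie_prod X]sf -limg_lie_prod limgS. Qed.

End Transport.

Lemma lie_isomorphicE (R : realType) (g h : lieAlgebra R) : lie_isomorphic g h ->
  exists (f : 'Hom(g, h)) (f' : 'Hom(h, g)),
   [/\ cancel f f', cancel f' f, {morph f : x y / bracket x y} &
    {morph f' : x y / bracket x y}].
Proof.
move=> [phi [psi phiK psiK] phiM].
have psi_lin : linear psi by move=> a x y; apply: (can_inj phiK); rewrite linearP !psiK.
pose H := GRing.isLinear.Build _ _ _ _ psi psi_lin.
pose P : {linear h -> g} := HB.pack psi H.
have PE : linfun P =1 psi by move=> x; rewrite lfunE.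
exists (linfun phi), (linfun P); split=> [x|x|x y|x y]; rewrite !lfunE /=.
- exact: phiK.
- exact: psiK.
- exact: phiM.
by apply: (can_inj phiK); rewrite phiM !psiK.
Qed.

Lemma lie_isomorphic_sym (R : realType) (g h : lieAlgebra R) :
  lie_isomorphic g h -> lie_isomorphic h g.
Proof.
by move=> /lie_isomorphicE[f [f' [fK f'K fM f'M]]]; exists f' => //; exists f.
Qed.

Lemma limg_can (R : realType) (g h : vectType R) (f : 'Hom(g, h)) (f' : 'Hom(h, g)) U :
  cancel f f' -> (f' @: (f @: U) = U)%VS.
Proof.
move=> fK; rewrite -limg_comp -[RHS]lim1g; congr (_ @: _)%VS.
by apply/lfunP => x; rewrite comp_lfunE id_lfunE fK.
Qed.

Lemma limg_can_full (R : realType) (g h : vectType R) (f : 'Hom(g, h)) (f' : 'Hom(h, g)) :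
  cancel f f' -> limg f' = fullv.
Proof.
move=> fK; apply/eqP; rewrite eqEsubv subvf /=; apply/subvP => x _.
by rewrite -(fK x) memv_img ?memvf.
Qed.

Lemma nilradical_limg (R : realType) (g h : lieAlgebra R) (f : 'Hom(g, h))
    (f' : 'Hom(h, g)) n :
  cancel f f' -> cancel f' f -> {morph f : x y / bracket x y} ->
  {morph f' : x y / bracket x y} ->
  is_nilradical n -> is_nilradical (f @: n)%VS.
Proof.
move=> fK f'K fM f'M [idn niln maxn]; split.
- by apply: ideal_limg => //; apply: limg_can_full f'K.
- exact: nilpotent_limg.
move=> m idm nilm; rewrite -(limg_can m f'K) limgS //; apply: maxn.
  by apply: ideal_limg => //; apply: limg_can_full fK.
exact: nilpotent_limg.
Qed.

Lemma SKT_transport (R : realType) (g h : lieAlgebra R) (n : {vspace g}) :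
  lie_isomorphic g h -> is_nilradical n ->
  (exists (J : 'End(h)) (met : h -> h -> R), is_SKT_adapted J met) ->
  exists (J : 'End(g)) (met : g -> g -> R),
    is_SKT J met /\ (J @: lcs n 1 <= n)%VS.
Proof.
move=> /lie_isomorphicE[f [f' [fK f'K fM f'M]]] nr [J [met [skt [n' nr' sJ]]]].
(* By uniqueness of the nilradical, the one provided on h is the image of n, so the condition on J
   n^1 can be pulled back. *)
have en : n' = (f @: n)%VS.
  by apply: nilradical_unique nr' _; apply: nilradical_limg fK f'K fM f'M nr.
exists (f' \o J \o f)%VF, (fun x y => met (f x) (f y)); split; last first.
  rewrite !limg_comp limg_lcs // -en -[X in (_ <= X)%VS](limg_can n fK) -en.
  exact: limgS.
have JE x : (f' \o J \o f)%VF x = f' (J (f x)) by rewrite !comp_lfunE.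
move/is_SKTP: skt => [[[JJ nij] [metr metC met_pos] metJ] skt]; apply/is_SKTP.
split; last first.
  move=> x y z w; rewrite -(skt (f x) (f y) (f z) (f w)) /dtorsion /torsion.
  by rewrite !JE !fM !f'K.
split; [split | split |].
- by move=> x; rewrite !JE f'K JJ linearN /= fK.
- move=> x y; apply: (can_inj fK); rewrite linear0 -[RHS](nij (f x) (f y)).
  by rewrite /nijenhuis !JE !linearB /= !fM !f'K.
- by move=> x a y z; rewrite linearP metr.
- by move=> x y; rewrite metC.
- by move=> x x0; apply: met_pos; rewrite -(linear0 f) (can_eq fK).
by move=> x y; rewrite !JE !f'K metJ.
Qed.

(** * Coordinates on rows, and the nilradical of the model algebras *)

Section Rows.
Variable R : realType.
Implicit Types (x y z : 'rV[R]_6).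

Definition row6 (a1 a2 a3 a4 a5 a6 : R) : 'rV[R]_6 :=
  \row_(k < 6) nth 0 [:: a1; a2; a3; a4; a5; a6] k.

Lemma row6E a1 a2 a3 a4 a5 a6 (x := row6 a1 a2 a3 a4 a5 a6) :
  (x 0 (ix 1) = a1) * (x 0 (ix 2) = a2) * (x 0 (ix 3) = a3) *
  (x 0 (ix 4) = a4) * (x 0 (ix 5) = a5) * (x 0 (ix 6) = a6).
Proof. by rewrite !mxE /ix /= !inordK. Qed.

Lemma rowDE x y k : (x + y) 0 k = x 0 k + y 0 k. Proof. by rewrite mxE. Qed.
Lemma rowNE x k : (- x) 0 k = - x 0 k. Proof. by rewrite mxE. Qed.
Lemma rowZE a x k : (a *: x) 0 k = a * x 0 k. Proof. by rewrite mxE. Qed.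
Lemma row0E k : (0 : 'rV[R]_6) 0 k = 0. Proof. by rewrite mxE. Qed.
Definition rowE := (rowDE, rowNE, rowZE, row0E, row6E).

Lemma fbE (k : nat) : fb R k = row6 (ix k == ix 1)%:R (ix k == ix 2)%:R
  (ix k == ix 3)%:R (ix k == ix 4)%:R (ix k == ix 5)%:R (ix k == ix 6)%:R.
Proof. by apply: row6P; rewrite row6E mxE eqxx eq_sym. Qed.

Lemma fb1 : fb R 1 = row6 1 0 0 0 0 0. Proof. by rewrite fbE !ix_inj. Qed.
Lemma fb2 : fb R 2 = row6 0 1 0 0 0 0. Proof. by rewrite fbE !ix_inj. Qed.
Lemma fb3 : fb R 3 = row6 0 0 1 0 0 0. Proof. by rewrite fbE !ix_inj. Qed.
Lemma fb4 : fb R 4 = row6 0 0 0 1 0 0. Proof. by rewrite fbE !ix_inj. Qed.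
Lemma fb5 : fb R 5 = row6 0 0 0 0 1 0. Proof. by rewrite fbE !ix_inj. Qed.
Lemma fb6 : fb R 6 = row6 0 0 0 0 0 1. Proof. by rewrite fbE !ix_inj. Qed.
Definition fb_row6 := (fb1, fb2, fb3, fb4, fb5, fb6).

Lemma row6_eta x : x = row6 (x 0 (ix 1)) (x 0 (ix 2)) (x 0 (ix 3))
  (x 0 (ix 4)) (x 0 (ix 5)) (x 0 (ix 6)).
Proof. by apply: row6P; rewrite !row6E. Qed.

(** The weight b is there for the two families: J f1 = a f2 is isometric only if f2 has length 1/a,
    that is b = a^-2. Elsewhere b = 1. *)
Definition wdot (b : R) x y : R :=
  x 0 (ix 1) * y 0 (ix 1) + b * (x 0 (ix 2) * y 0 (ix 2))
  + x 0 (ix 3) * y 0 (ix 3) + x 0 (ix 4) * y 0 (ix 4)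
  + x 0 (ix 5) * y 0 (ix 5) + x 0 (ix 6) * y 0 (ix 6).

Lemma wdot_inner b : 0 < b ->
  [/\ forall x, linear (wdot b x : 'rV[R]_6 -> R^o),
      forall x y, wdot b x y = wdot b y x & forall x, x != 0 -> 0 < wdot b x x].
Proof.
move=> b0; split=> [x c y z|x y|x].
- by rewrite /wdot !rowE /GRing.scale /=; ring.
- by rewrite /wdot; ring.
move=> xn0; rewrite ltNge; apply: contra xn0; rewrite /wdot -!expr2 => le0.
have ge0 k : 0 <= x 0 (ix k) ^+ 2 by exact: sqr_ge0.
have b2 : 0 <= b * x 0 (ix 2) ^+ 2 by rewrite mulr_ge0 // ltW.
have x0 k : x 0 (ix k) ^+ 2 = 0 -> x 0 (ix k) = 0 by move/eqP; rewrite sqrf_eq0 => /eqP.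
move: (ge0 1%N) (ge0 3%N) (ge0 4%N) (ge0 5%N) (ge0 6%N) => g1 g3 g4 g5 g6.
have /eqP : b * x 0 (ix 2) ^+ 2 = 0 by lra.
rewrite mulf_eq0 (gt_eqF b0) /= => /eqP z2.
by apply/eqP; apply: row6P; rewrite row0E; apply: x0 => //; lra.
Qed.

(** The 3-form f^ijk; the torsion forms are expanded in these. *)
Definition det3 i j k x y z : R :=
  x 0 (ix i) * (y 0 (ix j) * z 0 (ix k) - y 0 (ix k) * z 0 (ix j))
  - x 0 (ix j) * (y 0 (ix i) * z 0 (ix k) - y 0 (ix k) * z 0 (ix i))
  + x 0 (ix k) * (y 0 (ix i) * z 0 (ix j) - y 0 (ix j) * z 0 (ix i)).

(** The 2-form f^ij. As d f^k = - f^k([ , ]), a summand f^ij of d f^k contributes [wedge j i] to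
    coordinate k of the bracket, whence the swapped indices below. *)
Definition wedge i j x y : R :=
  x 0 (ix i) * y 0 (ix j) - x 0 (ix j) * y 0 (ix i).

Lemma row6_nth a1 a2 a3 a4 a5 a6 k : (0 < k <= 6)%N ->
  row6 a1 a2 a3 a4 a5 a6 0 (ix k) = [:: a1; a2; a3; a4; a5; a6]`_k.-1.
Proof. by case: k => [|[|[|[|[|[|[|k]]]]]]] // _; rewrite row6E. Qed.

Lemma wedge_row6 i j a1 a2 a3 a4 a5 a6 b1 b2 b3 b4 b5 b6
    (a := [:: a1; a2; a3; a4; a5; a6]) (b := [:: b1; b2; b3; b4; b5; b6]) :
  (0 < i <= 6)%N -> (0 < j <= 6)%N ->
  wedge i j (row6 a1 a2 a3 a4 a5 a6) (row6 b1 b2 b3 b4 b5 b6) =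
    a`_i.-1 * b`_j.-1 - a`_j.-1 * b`_i.-1.
Proof. by move=> i6 j6; rewrite /wedge !row6_nth. Qed.

Definition coord6 x : R^o := x 0 (ix 6).
Lemma coord6_linear : linear coord6.
Proof. by move=> a x y; rewrite /coord6 !rowE. Qed.
HB.instance Definition _ := GRing.isLinear.Build R 'rV[R]_6 R^o *:%R coord6 coord6_linear.

(** The span of f1, ..., f5, which is the nilradical of each of the six models. *)
Definition hyperplane6 : {vspace 'rV[R]_6} := lker (linfun coord6).

Lemma mem_hyperplane6 x : (x \in hyperplane6) = (x 0 (ix 6) == 0).
Proof. by rewrite memv_ker lfunE. Qed.

Lemma linear_lfun (L : 'rV[R]_6 -> 'rV[R]_6) : linear L ->
  exists J : 'End('rV[R]_6), J =1 L.
Proof.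
move=> Llin; pose H := GRing.isLinear.Build _ _ _ _ L Llin.
pose P : {linear 'rV[R]_6 -> 'rV[R]_6} := HB.pack L H.
by exists (linfun P) => x; rewrite lfunE.
Qed.

End Rows.

Section StrLie.
Variables (R : realType) (phi : seq 'M[R]_6) (laws : str_lie_laws phi).
Local Notation s := (str_lie laws).
Local Notation n := (hyperplane6 R : {vspace s}).
Implicit Types x y z : 'rV[R]_6.

Hypothesis br6 : forall x y, str_bracket phi x y 0 (ix 6) = 0.
Hypothesis br_n : forall x y, x 0 (ix 6) = 0 -> y 0 (ix 6) = 0 ->
  exists t, str_bracket phi x y = t *: fb R 1.
Hypothesis br_fb1 : forall x, str_bracket phi x (fb R 1) = 0.

Lemma lcs1_hyperplane6 : (lcs n 1 <= <[fb R 1 : s]>)%VS.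
Proof.
apply/lie_prod_subP => x y; rewrite !mem_hyperplane6 => /eqP x6 /eqP y6.
by have [t /= ->] := br_n x6 y6; rewrite memvZ ?memv_line.
Qed.

(* [Q] scales by a nonzero factor along the iterates of [ad x], for [x] outside
   of the hyperplane, so an ideal containing [x] is not nilpotent. *)
Lemma hyperplane6_nilradical (Q : 'rV[R]_6 -> R) c z0 :
  c != 0 -> Q 0 = 0 -> Q z0 != 0 -> z0 0 (ix 6) = 0 ->
  (forall x z, z 0 (ix 6) = 0 ->
    Q (str_bracket phi x z) = c * x 0 (ix 6) ^+ 2 * Q z) ->
  is_nilradical n.
Proof.
move=> c0 Q0 Qz0 z06 Qbr; split.
- by apply/lie_prod_subP => x y _ _; rewrite mem_hyperplane6 br6.
- exists 2%N; apply/eqP; rewrite -subv0; apply/lie_prod_subP => x y _ l1y.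
  have /vlineP[t ->] := subvP lcs1_hyperplane6 _ l1y.
  by rewrite linearZ /= br_fb1 scaler0 mem0v.
move=> m idm [l nilm]; apply/subvP => x mx; rewrite mem_hyperplane6.
apply/negPn/negP => x6.
have {}Qbr z : z 0 (ix 6) = 0 -> Q z != 0 -> Q (str_bracket phi x z) != 0.
  by move=> z6 Qz; rewrite Qbr // !mulf_neq0 // expf_neq0.
(* One bracket is taken in advance: z0 need not lie in m, but [x, z0] does, since x is in the ideal
   m. So [z 0] lies in [lcs m 0]. *)
pose z k := iter k.+1 (str_bracket phi x) z0.
have [zl6 [Qzl]] : z l 0 (ix 6) = 0 /\ Q (z l) != 0 /\ z l \in lcs m l.
  elim: (l) => [|k [z6 [Qz zm]]]; rewrite /z iterS.
    split; first exact: br6.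
    split; first exact: Qbr.
    have -> : str_bracket phi x (iter 0 (str_bracket phi x) z0) =
        - @bracket R s z0 x.
      by rewrite -bracketC.
    by rewrite memvN; apply: (idealP idm).
  split; first exact: br6.
  split; first exact: Qbr.
  exact: mem_lie_prod.
by rewrite nilm memv0 => /eqP zl0; rewrite zl0 Q0 eqxx in Qzl.
Qed.

Lemma str_lie_adapted (L : 'rV[R]_6 -> 'rV[R]_6) b :
  is_nilradical n -> 0 < b -> linear L ->
  (forall x, L (L x) = - x) ->
  (forall x y, str_bracket phi (L x) (L y) - L (str_bracket phi (L x) y)
     - L (str_bracket phi x (L y)) - str_bracket phi x y = 0) ->
  (forall x y, wdot b (L x) (L y) = wdot b x y) ->
  L (fb R 1) 0 (ix 6) = 0 ->
  (forall x y z w, dtorsion (str_bracket phi) L (wdot b) x y z w = 0) ->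
  exists J : 'End(s), [/\ J =1 L & is_SKT_adapted J (wdot b : s -> s -> R)].
Proof.
move=> nr b0 Llin LL nij met_L L6 skt.
have [J JL] := linear_lfun Llin; exists (J : 'End(s)); split=> //.
split; last first.
  exists n => //; apply/subvP => _ /memv_imgP[x l1x ->].
  have /vlineP[t ->] := subvP lcs1_hyperplane6 _ l1x.
  by rewrite linearZ /= JL memvZ // mem_hyperplane6 L6.
have [metr metC met_pos] := wdot_inner b0.
apply/is_SKTP; split; [split; [split | split |] |] => //.
- by move=> x; rewrite !JL LL.
- by move=> x y; rewrite /nijenhuis !JL nij.
- by move=> x y; rewrite !JL met_L.
by move=> x y z w; rewrite -(skt x y z w) /dtorsion /torsion !JL.
Qed.

End StrLie.

Lemma wdot_fb (R : realType) (b c : R) 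
    (e := [:: fb R 1; c *: fb R 2; fb R 3; fb R 4; fb R 5; fb R 6]) :
  b * c ^+ 2 = 1 ->
  forall i j : 'I_(size e), wdot b e`_i e`_j = (i == j)%:R.
Proof.
move=> bc; rewrite /e !fb_row6 => i j.
case: i => -[|[|[|[|[|[|i]]]]]] //= Hi; case: j => -[|[|[|[|[|[|j]]]]]] //= Hj.
all: rewrite /wdot !rowE; first [ring | by apply: etrans bc; ring].
Qed.

Ltac coords := apply: row6P; rewrite !rowE.

(** * The six explicit SKT structures *)

Section Examples.
Variable R : realType.
Implicit Types x y z : 'rV[R]_6.

Lemma s4_6_R2_SKT :
  exists (J : 'End(s4_6_R2 R)) (met : s4_6_R2 R -> s4_6_R2 R -> R),
     [/\ J (fb R 1) = fb R 2, J (fb R 3) = fb R 6, J (fb R 4) = fb R 5,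
         orthonormal_seq met
           [:: fb R 1; fb R 2; fb R 3; fb R 4; fb R 5; fb R 6]
       & is_SKT_adapted J met].
Proof.
(* The prescribed values of J, completed by J^2 = -1 and written in coordinates. *)
pose L x := row6
    (- x 0 (ix 2)) (x 0 (ix 1)) (- x 0 (ix 6))
    (- x 0 (ix 5)) (x 0 (ix 4)) (x 0 (ix 3)).
have LE x :
    (L x 0 (ix 1) = - x 0 (ix 2)) *
    (L x 0 (ix 2) = x 0 (ix 1)) *
    (L x 0 (ix 3) = - x 0 (ix 6)) *
    (L x 0 (ix 4) = - x 0 (ix 5)) *
    (L x 0 (ix 5) = x 0 (ix 4)) *
    (L x 0 (ix 6) = x 0 (ix 3)).
  by rewrite !row6E.
clearbody L.
have brE x y :
    (str_bracket (phi_4_6 R) x y 0 (ix 1) = wedge 3 2 x y) *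
    (str_bracket (phi_4_6 R) x y 0 (ix 2) = wedge 6 2 x y) *
    (str_bracket (phi_4_6 R) x y 0 (ix 3) = wedge 3 6 x y) *
    (str_bracket (phi_4_6 R) x y 0 (ix 4) = 0) *
    (str_bracket (phi_4_6 R) x y 0 (ix 5) = 0) *
    (str_bracket (phi_4_6 R) x y 0 (ix 6) = 0).
  by do ![split]; rewrite !str_bracketE //= !form2E /wedge; ring.
(* Computing T once, here as f^123, makes [dtorsion] a sum of six determinants instead of eighteen
   metric terms. *)
have torE x y z : torsion (str_bracket (phi_4_6 R)) L (wdot 1) x y z =
    det3 1 2 3 x y z.
  by rewrite /torsion /wdot /det3 !brE /wedge !LE; ring.
have br6 x y : str_bracket (phi_4_6 R) x y 0 (ix 6) = 0 by rewrite brE.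
have br_n x y : x 0 (ix 6) = 0 -> y 0 (ix 6) = 0 ->
    exists t, str_bracket (phi_4_6 R) x y = t *: fb R 1.
  move=> x6 y6; exists (wedge 3 2 x y).
  by rewrite fb_row6; coords; rewrite ?brE /wedge ?x6 ?y6; ring.
have nr : is_nilradical (hyperplane6 R : {vspace str_lie (laws_4_6 R)}).
  apply: (@hyperplane6_nilradical _ _ _ br6 br_n _
    (fun x => x 0 (ix 2) ^+ 2) 1 (fb R 2)).
  - by move=> x; rewrite fb_row6; coords; rewrite ?brE /wedge ?rowE; ring.
  - by rewrite ?expf_neq0 ?oner_eq0.
  - by rewrite !rowE; ring.
  - by rewrite fb_row6 !rowE ?expr0n ?addr0 expr1n oner_eq0.
  - by rewrite fb_row6 !rowE.
  - by move=> x z z6; rewrite !brE /wedge ?z6; ring.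
have [|||||||J [JL adJ]] :=
  @str_lie_adapted R (phi_4_6 R) (laws_4_6 R) br_n L 1 nr.
- by rewrite ?exprn_gt0 ?invr_gt0.
- by move=> c x y; coords; rewrite !LE !rowE; ring.
- by move=> x; coords; rewrite !LE; ring.
- by move=> x y; coords; rewrite !(brE, LE) /wedge ?LE; ring.
- by move=> x y; rewrite /wdot !LE; ring.
- by rewrite LE fb_row6 !rowE ?oppr0.
- by move=> x y z w; rewrite /dtorsion !torE /det3 !brE /wedge; ring.
exists J, (wdot 1); split=> //.
1-3: by rewrite JL; apply: row6P; rewrite !LE !fb_row6 !rowE; ring.
by rewrite -[fb R 2]scale1r; apply: wdot_fb; rewrite mul1r expr1n.
Qed.

Lemma s4_7_R2_SKT :
  exists (J : 'End(s4_7_R2 R)) (met : s4_7_R2 R -> s4_7_R2 R -> R),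
     [/\ J (fb R 1) = fb R 4, J (fb R 2) = fb R 3, J (fb R 5) = fb R 6,
         orthonormal_seq met
           [:: fb R 1; fb R 2; fb R 3; fb R 4; fb R 5; fb R 6]
       & is_SKT_adapted J met].
Proof.
pose L x := row6
    (- x 0 (ix 4)) (- x 0 (ix 3)) (x 0 (ix 2))
    (x 0 (ix 1)) (- x 0 (ix 6)) (x 0 (ix 5)).
have LE x :
    (L x 0 (ix 1) = - x 0 (ix 4)) *
    (L x 0 (ix 2) = - x 0 (ix 3)) *
    (L x 0 (ix 3) = x 0 (ix 2)) *
    (L x 0 (ix 4) = x 0 (ix 1)) *
    (L x 0 (ix 5) = - x 0 (ix 6)) *
    (L x 0 (ix 6) = x 0 (ix 5)).
  by rewrite !row6E.
clearbody L.
have brE x y :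
    (str_bracket (phi_4_7 R) x y 0 (ix 1) = wedge 3 2 x y) *
    (str_bracket (phi_4_7 R) x y 0 (ix 2) = wedge 6 3 x y) *
    (str_bracket (phi_4_7 R) x y 0 (ix 3) = wedge 2 6 x y) *
    (str_bracket (phi_4_7 R) x y 0 (ix 4) = 0) *
    (str_bracket (phi_4_7 R) x y 0 (ix 5) = 0) *
    (str_bracket (phi_4_7 R) x y 0 (ix 6) = 0).
  by do ![split]; rewrite !str_bracketE //= !form2E /wedge; ring.
have torE x y z : torsion (str_bracket (phi_4_7 R)) L (wdot 1) x y z =
    - det3 1 2 3 x y z.
  by rewrite /torsion /wdot /det3 !brE /wedge !LE; ring.
have br6 x y : str_bracket (phi_4_7 R) x y 0 (ix 6) = 0 by rewrite brE.
have br_n x y : x 0 (ix 6) = 0 -> y 0 (ix 6) = 0 ->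
    exists t, str_bracket (phi_4_7 R) x y = t *: fb R 1.
  move=> x6 y6; exists (wedge 3 2 x y).
  by rewrite fb_row6; coords; rewrite ?brE /wedge ?x6 ?y6; ring.
have nr : is_nilradical (hyperplane6 R : {vspace str_lie (laws_4_7 R)}).
  (* Modulo f1, ad f6 rotates the plane of f2 and f3: no single coordinate is scaled, but the
     squared length is. *)
  apply: (@hyperplane6_nilradical _ _ _ br6 br_n _
    (fun x => x 0 (ix 2) ^+ 2 + x 0 (ix 3) ^+ 2) 1 (fb R 2)).
  - by move=> x; rewrite fb_row6; coords; rewrite ?brE /wedge ?rowE; ring.
  - by rewrite ?expf_neq0 ?oner_eq0.
  - by rewrite !rowE; ring.
  - by rewrite fb_row6 !rowE ?expr0n ?addr0 expr1n oner_eq0.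
  - by rewrite fb_row6 !rowE.
  - by move=> x z z6; rewrite !brE /wedge ?z6; ring.
have [|||||||J [JL adJ]] :=
  @str_lie_adapted R (phi_4_7 R) (laws_4_7 R) br_n L 1 nr.
- by rewrite ?exprn_gt0 ?invr_gt0.
- by move=> c x y; coords; rewrite !LE !rowE; ring.
- by move=> x; coords; rewrite !LE; ring.
- by move=> x y; coords; rewrite !(brE, LE) /wedge ?LE; ring.
- by move=> x y; rewrite /wdot !LE; ring.
- by rewrite LE fb_row6 !rowE ?oppr0.
- by move=> x y z w; rewrite /dtorsion !torE /det3 !brE /wedge; ring.
exists J, (wdot 1); split=> //.
1-3: by rewrite JL; apply: row6P; rewrite !LE !fb_row6 !rowE; ring.
by rewrite -[fb R 2]scale1r; apply: wdot_fb; rewrite mul1r expr1n.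
Qed.

Lemma s6_25_SKT :
  exists (J : 'End(s6_25 R)) (met : s6_25 R -> s6_25 R -> R),
     [/\ J (fb R 1) = - fb R 5, J (fb R 2) = fb R 3, J (fb R 4) = fb R 6,
         orthonormal_seq met
           [:: fb R 1; fb R 2; fb R 3; fb R 4; fb R 5; fb R 6]
       & is_SKT_adapted J met].
Proof.
pose L x := row6
    (x 0 (ix 5)) (- x 0 (ix 3)) (x 0 (ix 2))
    (- x 0 (ix 6)) (- x 0 (ix 1)) (x 0 (ix 4)).
have LE x :
    (L x 0 (ix 1) = x 0 (ix 5)) *
    (L x 0 (ix 2) = - x 0 (ix 3)) *
    (L x 0 (ix 3) = x 0 (ix 2)) *
    (L x 0 (ix 4) = - x 0 (ix 6)) *
    (L x 0 (ix 5) = - x 0 (ix 1)) *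
    (L x 0 (ix 6) = x 0 (ix 4)).
  by rewrite !row6E.
clearbody L.
have brE x y :
    (str_bracket (phi_6_25 R) x y 0 (ix 1) = wedge 3 2 x y) *
    (str_bracket (phi_6_25 R) x y 0 (ix 2) = wedge 6 3 x y) *
    (str_bracket (phi_6_25 R) x y 0 (ix 3) = wedge 2 6 x y) *
    (str_bracket (phi_6_25 R) x y 0 (ix 4) = 0) *
    (str_bracket (phi_6_25 R) x y 0 (ix 5) = wedge 6 4 x y) *
    (str_bracket (phi_6_25 R) x y 0 (ix 6) = 0).
  by do ![split]; rewrite !str_bracketE //= !form2E /wedge; ring.
have torE x y z : torsion (str_bracket (phi_6_25 R)) L (wdot 1) x y z =
    - det3 1 2 3 x y z + det3 4 5 6 x y z.
  by rewrite /torsion /wdot /det3 !brE /wedge !LE; ring.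
have br6 x y : str_bracket (phi_6_25 R) x y 0 (ix 6) = 0 by rewrite brE.
have br_n x y : x 0 (ix 6) = 0 -> y 0 (ix 6) = 0 ->
    exists t, str_bracket (phi_6_25 R) x y = t *: fb R 1.
  move=> x6 y6; exists (wedge 3 2 x y).
  by rewrite fb_row6; coords; rewrite ?brE /wedge ?x6 ?y6; ring.
have nr : is_nilradical (hyperplane6 R : {vspace str_lie (laws_6_25 R)}).
  apply: (@hyperplane6_nilradical _ _ _ br6 br_n _
    (fun x => x 0 (ix 2) ^+ 2 + x 0 (ix 3) ^+ 2) 1 (fb R 2)).
  - by move=> x; rewrite fb_row6; coords; rewrite ?brE /wedge ?rowE; ring.
  - by rewrite ?expf_neq0 ?oner_eq0.
  - by rewrite !rowE; ring.
  - by rewrite fb_row6 !rowE ?expr0n ?addr0 expr1n oner_eq0.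
  - by rewrite fb_row6 !rowE.
  - by move=> x z z6; rewrite !brE /wedge ?z6; ring.
have [|||||||J [JL adJ]] :=
  @str_lie_adapted R (phi_6_25 R) (laws_6_25 R) br_n L 1 nr.
- by rewrite ?exprn_gt0 ?invr_gt0.
- by move=> c x y; coords; rewrite !LE !rowE; ring.
- by move=> x; coords; rewrite !LE; ring.
- by move=> x y; coords; rewrite !(brE, LE) /wedge ?LE; ring.
- by move=> x y; rewrite /wdot !LE; ring.
- by rewrite LE fb_row6 !rowE ?oppr0.
- by move=> x y z w; rewrite /dtorsion !torE /det3 !brE /wedge; ring.
exists J, (wdot 1); split=> //.
1-3: by rewrite JL; apply: row6P; rewrite !LE !fb_row6 !rowE; ring.
by rewrite -[fb R 2]scale1r; apply: wdot_fb; rewrite mul1r expr1n.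
Qed.

Lemma s6_51_SKT (a : R) : 0 < a ->
  exists (J : 'End(s6_51 a)) (met : s6_51 a -> s6_51 a -> R),
     [/\ J (fb R 1) = a *: fb R 2, J (fb R 3) = fb R 6, J (fb R 4) = fb R 5,
         orthonormal_seq met
           [:: fb R 1; a *: fb R 2; fb R 3; fb R 4; fb R 5; fb R 6]
       & is_SKT_adapted J met].
Proof.
move=> a0; have an0 : a != 0 by rewrite gt_eqF.
(* J f1 = a f2 forces J f2 = - f1 / a. *)
pose L x := row6
    (- (a^-1 * x 0 (ix 2))) (a * x 0 (ix 1)) (- x 0 (ix 6))
    (- x 0 (ix 5)) (x 0 (ix 4)) (x 0 (ix 3)).
have LE x :
    (L x 0 (ix 1) = - (a^-1 * x 0 (ix 2))) *
    (L x 0 (ix 2) = a * x 0 (ix 1)) *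
    (L x 0 (ix 3) = - x 0 (ix 6)) *
    (L x 0 (ix 4) = - x 0 (ix 5)) *
    (L x 0 (ix 5) = x 0 (ix 4)) *
    (L x 0 (ix 6) = x 0 (ix 3)).
  by rewrite !row6E.
clearbody L.
have brE x y :
    (str_bracket (phi_6_51 a) x y 0 (ix 1) = wedge 3 2 x y) *
    (str_bracket (phi_6_51 a) x y 0 (ix 2) = a * wedge 6 2 x y) *
    (str_bracket (phi_6_51 a) x y 0 (ix 3) = a * wedge 3 6 x y) *
    (str_bracket (phi_6_51 a) x y 0 (ix 4) = wedge 6 5 x y) *
    (str_bracket (phi_6_51 a) x y 0 (ix 5) = wedge 4 6 x y) *
    (str_bracket (phi_6_51 a) x y 0 (ix 6) = 0).
  by do ![split]; rewrite !str_bracketE //= !form2E /wedge; ring.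
have torE x y z : torsion (str_bracket (phi_6_51 a)) L (wdot (a^-1 ^+ 2)) x y z =
    det3 1 2 3 x y z.
  by rewrite /torsion /wdot /det3 !brE /wedge !LE; field.
have br6 x y : str_bracket (phi_6_51 a) x y 0 (ix 6) = 0 by rewrite brE.
have br_n x y : x 0 (ix 6) = 0 -> y 0 (ix 6) = 0 ->
    exists t, str_bracket (phi_6_51 a) x y = t *: fb R 1.
  move=> x6 y6; exists (wedge 3 2 x y).
  by rewrite fb_row6; coords; rewrite ?brE /wedge ?x6 ?y6; ring.
have nr : is_nilradical (hyperplane6 R : {vspace str_lie (laws_6_51 a)}).
  apply: (@hyperplane6_nilradical _ _ _ br6 br_n _
    (fun x => x 0 (ix 2) ^+ 2) (a ^+ 2) (fb R 2)).
  - by move=> x; rewrite fb_row6; coords; rewrite ?brE /wedge ?rowE; ring.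
  - by rewrite ?expf_neq0 ?oner_eq0.
  - by rewrite !rowE; ring.
  - by rewrite fb_row6 !rowE ?expr0n ?addr0 expr1n oner_eq0.
  - by rewrite fb_row6 !rowE.
  - by move=> x z z6; rewrite !brE /wedge ?z6; ring.
have [|||||||J [JL adJ]] :=
  @str_lie_adapted R (phi_6_51 a) (laws_6_51 a) br_n L (a^-1 ^+ 2) nr.
- by rewrite ?exprn_gt0 ?invr_gt0.
- by move=> c x y; coords; rewrite !LE !rowE; ring.
- by move=> x; coords; rewrite !LE; field.
- by move=> x y; coords; rewrite !(brE, LE) /wedge ?LE; field.
- by move=> x y; rewrite /wdot !LE; field.
- by rewrite LE fb_row6 !rowE ?oppr0.
- by move=> x y z w; rewrite /dtorsion !torE /det3 !brE /wedge; ring.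
exists J, (wdot (a^-1 ^+ 2)); split=> //.
1-3: by rewrite JL; apply: row6P; rewrite !LE !fb_row6 !rowE; ring.
by apply: wdot_fb; rewrite -exprMn mulVf // expr1n.
Qed.

Lemma s6_158_SKT :
  exists (J : 'End(s6_158 R)) (met : s6_158 R -> s6_158 R -> R),
     [/\ J (fb R 1) = fb R 3, J (fb R 2) = fb R 4, J (fb R 5) = fb R 6,
         orthonormal_seq met
           [:: fb R 1; fb R 2; fb R 3; fb R 4; fb R 5; fb R 6]
       & is_SKT_adapted J met].
Proof.
pose L x := row6
    (- x 0 (ix 3)) (- x 0 (ix 4)) (x 0 (ix 1))
    (x 0 (ix 2)) (- x 0 (ix 6)) (x 0 (ix 5)).
have LE x :
    (L x 0 (ix 1) = - x 0 (ix 3)) *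
    (L x 0 (ix 2) = - x 0 (ix 4)) *
    (L x 0 (ix 3) = x 0 (ix 1)) *
    (L x 0 (ix 4) = x 0 (ix 2)) *
    (L x 0 (ix 5) = - x 0 (ix 6)) *
    (L x 0 (ix 6) = x 0 (ix 5)).
  by rewrite !row6E.
clearbody L.
have brE x y :
    (str_bracket (phi_6_158 R) x y 0 (ix 1) = wedge 4 2 x y + wedge 5 3 x y) *
    (str_bracket (phi_6_158 R) x y 0 (ix 2) = 0) *
    (str_bracket (phi_6_158 R) x y 0 (ix 3) = wedge 6 3 x y) *
    (str_bracket (phi_6_158 R) x y 0 (ix 4) = 0) *
    (str_bracket (phi_6_158 R) x y 0 (ix 5) = wedge 5 6 x y) *
    (str_bracket (phi_6_158 R) x y 0 (ix 6) = 0).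
  by do ![split]; rewrite !str_bracketE //= !form2E /wedge; ring.
have torE x y z : torsion (str_bracket (phi_6_158 R)) L (wdot 1) x y z =
    - det3 1 2 4 x y z + det3 1 3 5 x y z.
  by rewrite /torsion /wdot /det3 !brE /wedge !LE; ring.
have br6 x y : str_bracket (phi_6_158 R) x y 0 (ix 6) = 0 by rewrite brE.
have br_n x y : x 0 (ix 6) = 0 -> y 0 (ix 6) = 0 ->
    exists t, str_bracket (phi_6_158 R) x y = t *: fb R 1.
  move=> x6 y6; exists (wedge 4 2 x y + wedge 5 3 x y).
  by rewrite fb_row6; coords; rewrite ?brE /wedge ?x6 ?y6; ring.
have nr : is_nilradical (hyperplane6 R : {vspace str_lie (laws_6_158 R)}).
  (* Here ad f6 kills f2, and the eigenvector f3 takes its place. *)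
  apply: (@hyperplane6_nilradical _ _ _ br6 br_n _
    (fun x => x 0 (ix 3) ^+ 2) 1 (fb R 3)).
  - by move=> x; rewrite fb_row6; coords; rewrite ?brE /wedge ?rowE; ring.
  - by rewrite ?expf_neq0 ?oner_eq0.
  - by rewrite !rowE; ring.
  - by rewrite fb_row6 !rowE ?expr0n ?addr0 expr1n oner_eq0.
  - by rewrite fb_row6 !rowE.
  - by move=> x z z6; rewrite !brE /wedge ?z6; ring.
have [|||||||J [JL adJ]] :=
  @str_lie_adapted R (phi_6_158 R) (laws_6_158 R) br_n L 1 nr.
- by rewrite ?exprn_gt0 ?invr_gt0.
- by move=> c x y; coords; rewrite !LE !rowE; ring.
- by move=> x; coords; rewrite !LE; ring.
- by move=> x y; coords; rewrite !(brE, LE) /wedge ?LE; ring.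
- by move=> x y; rewrite /wdot !LE; ring.
- by rewrite LE fb_row6 !rowE ?oppr0.
- by move=> x y z w; rewrite /dtorsion !torE /det3 !brE /wedge; ring.
exists J, (wdot 1); split=> //.
1-3: by rewrite JL; apply: row6P; rewrite !LE !fb_row6 !rowE; ring.
by rewrite -[fb R 2]scale1r; apply: wdot_fb; rewrite mul1r expr1n.
Qed.

Lemma s6_164_SKT (a : R) : 0 < a ->
  exists (J : 'End(s6_164 a)) (met : s6_164 a -> s6_164 a -> R),
     [/\ J (fb R 1) = a *: fb R 2, J (fb R 3) = fb R 5, J (fb R 4) = fb R 6,
         orthonormal_seq met
           [:: fb R 1; a *: fb R 2; fb R 3; fb R 4; fb R 5; fb R 6]
       & is_SKT_adapted J met].
Proof.
move=> a0; have an0 : a != 0 by rewrite gt_eqF.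
pose L x := row6
    (- (a^-1 * x 0 (ix 2))) (a * x 0 (ix 1)) (- x 0 (ix 5))
    (- x 0 (ix 6)) (x 0 (ix 3)) (x 0 (ix 4)).
have LE x :
    (L x 0 (ix 1) = - (a^-1 * x 0 (ix 2))) *
    (L x 0 (ix 2) = a * x 0 (ix 1)) *
    (L x 0 (ix 3) = - x 0 (ix 5)) *
    (L x 0 (ix 4) = - x 0 (ix 6)) *
    (L x 0 (ix 5) = x 0 (ix 3)) *
    (L x 0 (ix 6) = x 0 (ix 4)).
  by rewrite !row6E.
clearbody L.
have brE x y :
    (str_bracket (phi_6_164 a) x y 0 (ix 1) = wedge 4 2 x y + wedge 5 3 x y) *
    (str_bracket (phi_6_164 a) x y 0 (ix 2) = a * wedge 6 2 x y) *
    (str_bracket (phi_6_164 a) x y 0 (ix 3) = wedge 6 5 x y) *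
    (str_bracket (phi_6_164 a) x y 0 (ix 4) = a * wedge 4 6 x y) *
    (str_bracket (phi_6_164 a) x y 0 (ix 5) = wedge 3 6 x y) *
    (str_bracket (phi_6_164 a) x y 0 (ix 6) = 0).
  by do ![split]; rewrite !str_bracketE //= !form2E /wedge; ring.
have torE x y z : torsion (str_bracket (phi_6_164 a)) L (wdot (a^-1 ^+ 2)) x y z =
    det3 1 2 4 x y z - det3 1 3 5 x y z.
  by rewrite /torsion /wdot /det3 !brE /wedge !LE; field.
have br6 x y : str_bracket (phi_6_164 a) x y 0 (ix 6) = 0 by rewrite brE.
have br_n x y : x 0 (ix 6) = 0 -> y 0 (ix 6) = 0 ->
    exists t, str_bracket (phi_6_164 a) x y = t *: fb R 1.
  move=> x6 y6; exists (wedge 4 2 x y + wedge 5 3 x y).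
  by rewrite fb_row6; coords; rewrite ?brE /wedge ?x6 ?y6; ring.
have nr : is_nilradical (hyperplane6 R : {vspace str_lie (laws_6_164 a)}).
  apply: (@hyperplane6_nilradical _ _ _ br6 br_n _
    (fun x => x 0 (ix 2) ^+ 2) (a ^+ 2) (fb R 2)).
  - by move=> x; rewrite fb_row6; coords; rewrite ?brE /wedge ?rowE; ring.
  - by rewrite ?expf_neq0 ?oner_eq0.
  - by rewrite !rowE; ring.
  - by rewrite fb_row6 !rowE ?expr0n ?addr0 expr1n oner_eq0.
  - by rewrite fb_row6 !rowE.
  - by move=> x z z6; rewrite !brE /wedge ?z6; ring.
have [|||||||J [JL adJ]] :=
  @str_lie_adapted R (phi_6_164 a) (laws_6_164 a) br_n L (a^-1 ^+ 2) nr.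
- by rewrite ?exprn_gt0 ?invr_gt0.
- by move=> c x y; coords; rewrite !LE !rowE; ring.
- by move=> x; coords; rewrite !LE; field.
- by move=> x y; coords; rewrite !(brE, LE) /wedge ?LE; field.
- by move=> x y; rewrite /wdot !LE; field.
- by rewrite LE fb_row6 !rowE ?oppr0.
- by move=> x y z w; rewrite /dtorsion !torE /det3 !brE /wedge; ring.
exists J, (wdot (a^-1 ^+ 2)); split=> //.
1-3: by rewrite JL; apply: row6P; rewrite !LE !fb_row6 !rowE; ring.
by apply: wdot_fb; rewrite -exprMn mulVf // expr1n.
Qed.

End Examples.

(** * Isomorphisms from the six models to the frame bracket *)

Section NormalForms.
Variable R : realType.
Implicit Types (x y z : 'rV[R]_6) (br : 'rV[R]_6 -> 'rV[R]_6 -> 'rV[R]_6).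

(** A left inverse is enough: an injective linear endomorphism in finite dimension is bijective. The
    images under [th] of the rows f_k are the model basis inside the frame. *)
Definition coord_iso br (phi : seq 'M[R]_6) : Prop :=
  exists th th' : 'rV[R]_6 -> 'rV[R]_6, [/\ linear th, cancel th th' &
    forall x y, br (th x) (th y) = th (str_bracket phi x y)].

Definition J0 x : 'rV[R]_6 :=
  row6 (- x 0 (ix 2)) (x 0 (ix 1)) (- x 0 (ix 4)) (x 0 (ix 3))
       (- x 0 (ix 6)) (x 0 (ix 5)).

(* The bracket in the unitary basis of the header, with [fb i] for e_i. *)
Definition frame_br (c x2 x3 x4 a1 a2 p q m v1 v2 v3 v4 : R) x y : 'rV[R]_6 :=
  row6
    (c * wedge 3 4 x y + x2 * wedge 5 2 x y + x3 * wedge 5 3 x y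
      + x4 * wedge 5 4 x y + a1 * wedge 6 3 x y + (x3 - a2) * wedge 6 4 x y
      + v1 * wedge 6 5 x y)
    (x2 * wedge 6 2 x y + a2 * wedge 6 3 x y + (x4 + a1) * wedge 6 4 x y
      + v2 * wedge 6 5 x y)
    (p * wedge 6 3 x y - q * wedge 6 4 x y + v3 * wedge 6 5 x y)
    (q * wedge 6 3 x y + p * wedge 6 4 x y + v4 * wedge 6 5 x y)
    (m * wedge 6 5 x y) 0.

(** The sign is absorbed in a change of basis, so that the parameter a of a family is positive.
    Having it as 1 or -1 lets [field] treat the two cases. *)
Lemma sign_pos (r : R) : r != 0 ->
  exists2 s : R, s = 1 \/ s = -1 & 0 < s * r.
Proof.
rewrite neq_lt => /orP[r0|r0]; [exists (-1)|exists 1]; rewrite ?mulN1r ?mul1r ?oppr_gt0 //.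
- by right.
- by left.
Qed.

Lemma J0E x : (J0 x 0 (ix 1) = - x 0 (ix 2)) * (J0 x 0 (ix 2) = x 0 (ix 1)) *
  (J0 x 0 (ix 3) = - x 0 (ix 4)) * (J0 x 0 (ix 4) = x 0 (ix 3)) *
  (J0 x 0 (ix 5) = - x 0 (ix 6)) * (J0 x 0 (ix 6) = x 0 (ix 5)).
Proof. by rewrite !row6E. Qed.

Section Cases.
Variables (c x2 x3 x4 q v1 v2 v3 v4 : R).
Local Notation br := (frame_br c x2 x3 x4 (- x4) 0 0 q (- x2) v1 v2 v3 v4).
(** [c1] is the SKT equation at (e3, e4, e5, e6); [c3] and [c4] are the Jacobi identities at (e4,
    e5, e6) and (e3, e5, e6). For c nonzero they determine v1, v3 and v4. *)
Hypotheses (c1 : c * v1 = - (x3 ^+ 2 + x4 ^+ 2)) (c3 : c * v3 = q * x3 + x2 * x4)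
  (c4 : c * v4 = q * x4 - x2 * x3).

Let solve1 w r : c != 0 -> c * w = r -> w = r / c.
Proof. by move=> c0 <-; rewrite mulrC mulKf. Qed.

(* Replacing e5 by e5 - (x4 / c) e3 + (x3 / c) e4 and e6 by
   e6 - (x3 / c) e3 - (x4 / c) e4 splits off the Heisenberg algebra spanned by
   e1, e3, e4. *)
Lemma case_s6_158 : c != 0 -> x2 != 0 -> q = 0 -> coord_iso br (phi_6_158 R).
Proof.
move=> c0 x20 q0.
have e1 := solve1 c0 c1; have e3 := solve1 c0 c3; have e4 := solve1 c0 c4.
(* The corrected e5 satisfies D e5 = v2 e2 - x2 e5 modulo e1, while D e2 = x2 e2; subtracting v2 /
   (2 x2) e2 gives an eigenvector f5. The factor - x2 / c in f4 makes [f2, f4] equal to [f3, f5]. *)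
exists (fun x => row6 (x2 * x 0 (ix 1)) (x 0 (ix 3) - v2 / (2 * x2) * x 0 (ix 5))
  (x 0 (ix 2) - x4 / c * x 0 (ix 5) - x3 / c / x2 * x 0 (ix 6))
  (- (x2 / c) * x 0 (ix 4) + x3 / c * x 0 (ix 5) - x4 / c / x2 * x 0 (ix 6))
  (x 0 (ix 5)) (x 0 (ix 6) / x2)).
exists (fun y => row6 (y 0 (ix 1) / x2)
  (y 0 (ix 3) + x4 / c * y 0 (ix 5) + x3 / c * y 0 (ix 6))
  (y 0 (ix 2) + v2 / (2 * x2) * y 0 (ix 5))
  (- (c / x2) * (y 0 (ix 4) - x3 / c * y 0 (ix 5) + x4 / c * y 0 (ix 6)))
  (y 0 (ix 5)) (x2 * y 0 (ix 6))).
split=> [a x y|x|x y] /=; rewrite /frame_br ?wedge_row6 //=; coords;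
  try by field; rewrite ?c0 ?x20.
all: rewrite !str_bracketE //= !form2E.
all: by rewrite ?e1 ?e3 ?e4 ?q0; field; rewrite ?c0 ?x20.
Qed.

Lemma case_s6_164 : c != 0 -> x2 != 0 -> q != 0 ->
  exists a, 0 < a /\ coord_iso br (phi_6_164 a).
Proof.
move=> c0 x20 q0.
have e1 := solve1 c0 c1; have e3 := solve1 c0 c3; have e4 := solve1 c0 c4.
have [eps eps1 eps_gt0] := sign_pos (mulf_neq0 x20 (invr_neq0 q0)).
have [sg sg1 sg_gt0] := sign_pos (mulf_neq0 x20 (invr_neq0 c0)).
(* f3 and f5 span the plane rotated by D, so they are scaled by the same factor u up to sign. The
   requirement [f3, f5] = [f2, f4] then forces u^2 = |x2 / c|; the sign [sg] goes into f1 and f2. *)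
pose u := Num.sqrt (sg * (x2 / c)).
have u0 : u != 0 by rewrite sqrtr_eq0 -ltNge.
have cE : c = sg * x2 / u ^+ 2.
  by rewrite sqr_sqrtr ?ltW //; case: sg1 => ->; field; rewrite c0 x20.
(* Dividing e6 by eps q gives the rotation unit speed, which leaves a = |x2 / q|. *)
exists (x2 / (eps * q)); split.
  by case: eps1 eps_gt0 => ->; rewrite !(mul1r, mulN1r) ?invrN ?mulrN.
exists (fun x => row6 (sg * eps * x2 * x 0 (ix 1))
  (sg * eps * x 0 (ix 2) - v2 / (2 * x2) * x 0 (ix 4))
  (u * x 0 (ix 5) - x4 / c * x 0 (ix 4) - x3 / c / (eps * q) * x 0 (ix 6))
  (eps * u * x 0 (ix 3) + x3 / c * x 0 (ix 4) - x4 / c / (eps * q) * x 0 (ix 6))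
  (x 0 (ix 4)) (x 0 (ix 6) / (eps * q))).
exists (fun y => row6 (y 0 (ix 1) / (sg * eps * x2))
  (sg * eps * (y 0 (ix 2) + v2 / (2 * x2) * y 0 (ix 5)))
  (eps / u * (y 0 (ix 4) - x3 / c * y 0 (ix 5) + x4 / c * y 0 (ix 6)))
  (y 0 (ix 5))
  ((y 0 (ix 3) + x4 / c * y 0 (ix 5) + x3 / c * y 0 (ix 6)) / u)
  (eps * q * y 0 (ix 6))).
split=> [a x y|x|x y] /=; rewrite /frame_br ?wedge_row6 //=; coords.
all: rewrite ?str_bracketE //= ?form2E ?e1 ?e3 ?e4 ?cE.
all: clearbody u.
all: by case: eps1 => E1; case: sg1 => E2; rewrite ?E1 ?E2; field; rewrite ?u0 ?q0 ?x20.
Qed.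

(** With x2 = v2 = 0, both e2 and the corrected e5 are central and span the summand R^2; D rotates
    the Heisenberg plane of e3 and e4. *)
Lemma case_s4_7 : c != 0 -> x2 = 0 -> q != 0 -> v2 = 0 -> coord_iso br (phi_4_7 R).
Proof.
move=> c0 x20 q0 v20.
have e1 := solve1 c0 c1; have e3 := solve1 c0 c3; have e4 := solve1 c0 c4.
exists (fun x => row6 (c * x 0 (ix 1)) (x 0 (ix 4))
  (x 0 (ix 3) - x4 / c * x 0 (ix 5) - x3 / c / q * x 0 (ix 6))
  (x 0 (ix 2) + x3 / c * x 0 (ix 5) - x4 / c / q * x 0 (ix 6))
  (x 0 (ix 5)) (x 0 (ix 6) / q)).
exists (fun y => row6 (y 0 (ix 1) / c)
  (y 0 (ix 4) - x3 / c * y 0 (ix 5) + x4 / c * y 0 (ix 6))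
  (y 0 (ix 3) + x4 / c * y 0 (ix 5) + x3 / c * y 0 (ix 6))
  (y 0 (ix 2))
  (y 0 (ix 5)) (q * y 0 (ix 6))).
split=> [a x y|x|x y] /=; rewrite /frame_br ?wedge_row6 //=; coords;
  try by field; rewrite ?c0 ?q0.
all: rewrite !str_bracketE //= !form2E.
all: by rewrite ?e1 ?e3 ?e4 ?x20 ?v20; field; rewrite ?c0 ?q0.
Qed.

(** The corrected e5 now satisfies D e5 = v2 e2 with v2 nonzero. So f4 and f5 are no longer both
    central: f5 = (v2 / q) e2 is [f6, f4]. *)
Lemma case_s6_25 : c != 0 -> x2 = 0 -> q != 0 -> v2 != 0 -> coord_iso br (phi_6_25 R).
Proof.
move=> c0 x20 q0 v20.
have e1 := solve1 c0 c1; have e3 := solve1 c0 c3; have e4 := solve1 c0 c4.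
exists (fun x => row6 (c * x 0 (ix 1)) (v2 / q * x 0 (ix 5))
  (x 0 (ix 3) - x4 / c * x 0 (ix 4) - x3 / c / q * x 0 (ix 6))
  (x 0 (ix 2) + x3 / c * x 0 (ix 4) - x4 / c / q * x 0 (ix 6))
  (x 0 (ix 4)) (x 0 (ix 6) / q)).
exists (fun y => row6 (y 0 (ix 1) / c)
  (y 0 (ix 4) - x3 / c * y 0 (ix 5) + x4 / c * y 0 (ix 6))
  (y 0 (ix 3) + x4 / c * y 0 (ix 5) + x3 / c * y 0 (ix 6))
  (y 0 (ix 5)) (q / v2 * y 0 (ix 2))
  (q * y 0 (ix 6))).
split=> [a x y|x|x y] /=; rewrite /frame_br ?wedge_row6 //=; coords;
  try by field; rewrite ?c0 ?q0 ?v20.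
all: rewrite !str_bracketE //= !form2E.
all: by rewrite ?e1 ?e3 ?e4 ?x20; field; rewrite ?c0 ?q0.
Qed.

End Cases.

Section AbelianCases.
Variables (x2 q v1 v2 v3 v4 : R).
Local Notation br := (frame_br 0 x2 0 0 0 0 0 q (- x2) v1 v2 v3 v4).
Hypothesis x20 : x2 != 0.
(* k3 e3 + k4 e4 is added to e5 to make it an eigenvector of D modulo e1, e2. *)
Let k3 := - (x2 * v3 + q * v4) / (x2 ^+ 2 + q ^+ 2).
Let k4 := (q * v3 - x2 * v4) / (x2 ^+ 2 + q ^+ 2).
Let x2q : x2 ^+ 2 + q ^+ 2 != 0.
Proof. by rewrite paddr_eq0 ?sqr_ge0 // sqrf_eq0 (negPf x20). Qed.

Lemma case_s4_6 : q = 0 -> coord_iso br (phi_4_6 R).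
Proof.
move=> q0.
(* Besides k3 and k4, the coefficients - v1 / x2 on e1 and - v2 / (2 x2) on e2 make f3 an
   eigenvector of D for - x2, since D e1 = 0 and D e2 = x2 e2. *)
exists (fun x => row6 (x2 * x 0 (ix 1) - v1 / x2 * x 0 (ix 3))
  (x 0 (ix 2) - v2 / (2 * x2) * x 0 (ix 3))
  (x 0 (ix 4) + k3 * x 0 (ix 3)) (x 0 (ix 5) + k4 * x 0 (ix 3))
  (x 0 (ix 3)) (x 0 (ix 6) / x2)).
exists (fun y => row6 ((y 0 (ix 1) + v1 / x2 * y 0 (ix 5)) / x2)
  (y 0 (ix 2) + v2 / (2 * x2) * y 0 (ix 5))
  (y 0 (ix 5)) (y 0 (ix 3) - k3 * y 0 (ix 5)) (y 0 (ix 4) - k4 * y 0 (ix 5))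
  (x2 * y 0 (ix 6))).
split=> [a x y|x|x y] /=; rewrite /frame_br ?wedge_row6 //=; coords.
all: rewrite ?str_bracketE //= ?form2E /k3 /k4 ?q0 ?expr0n ?addr0.
all: by field; rewrite ?x20.
Qed.

Lemma case_s6_51 : q != 0 -> exists a, 0 < a /\ coord_iso br (phi_6_51 a).
Proof.
move=> q0.
have [eps eps1 eps_gt0] := sign_pos (mulf_neq0 x20 (invr_neq0 q0)).
exists (x2 / (eps * q)); split.
  by case: eps1 eps_gt0 => ->; rewrite !(mul1r, mulN1r) ?invrN ?mulrN.
exists (fun x => row6 (x2 * x 0 (ix 1) - v1 / x2 * x 0 (ix 3))
  (x 0 (ix 2) - v2 / (2 * x2) * x 0 (ix 3))
  (x 0 (ix 5) + k3 * x 0 (ix 3)) (eps * x 0 (ix 4) + k4 * x 0 (ix 3))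
  (x 0 (ix 3)) (x 0 (ix 6) / (eps * q))).
exists (fun y => row6 ((y 0 (ix 1) + v1 / x2 * y 0 (ix 5)) / x2)
  (y 0 (ix 2) + v2 / (2 * x2) * y 0 (ix 5))
  (y 0 (ix 5)) (eps * (y 0 (ix 4) - k4 * y 0 (ix 5))) (y 0 (ix 3) - k3 * y 0 (ix 5))
  (eps * q * y 0 (ix 6))).
split=> [a x y|x|x y] /=; rewrite /frame_br ?wedge_row6 //=; coords.
all: rewrite ?str_bracketE //= ?form2E /k3 /k4.
all: by case: eps1 => E1; rewrite ?E1; field; rewrite ?x20 ?q0 ?x2q.
Qed.

End AbelianCases.
End NormalForms.

(** * From the polynomial equations to the six cases *)

Section Classification.
Variable R : realType.

(** The two equations are the real and imaginary parts of (a + i b)(r + i s) = 0. *)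
Lemma sum_sqr_eq0 (a b r s : R) :
  ~ (a = 0 /\ b = 0) -> a * r = b * s -> b * r = - (a * s) -> r = 0 /\ s = 0.
Proof.
move=> ab0 e1 e2.
have d0 : a ^+ 2 + b ^+ 2 != 0.
  by rewrite paddr_eq0 ?sqr_ge0 // !sqrf_eq0; apply/negP => /andP[/eqP ? /eqP ?]; apply: ab0.
split; apply: (mulfI d0); rewrite mulr0.
  rewrite mulrDl !expr2 -!mulrA e1 e2; ring.
have e1' : b * s = a * r by [].
have e2' : a * s = - (b * r) by rewrite e2 opprK.
rewrite mulrDl !expr2 -!mulrA e1' e2'; ring.
Qed.

Section FrameTorsion.
Variables (c x2 x3 x4 a1 a2 p q m v1 v2 v3 v4 : R).
Local Notation br := (frame_br c x2 x3 x4 a1 a2 p q m v1 v2 v3 v4).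

(** Expanding T in the 3-forms f^ijk lets the SKT equations be read off at quadruples of basis
    vectors. *)
Lemma frame_torsionE x y z : torsion br (@J0 R) (wdot 1) x y z =
  x2 * det3 1 2 5 x y z + c * det3 1 3 4 x y z + (a2 - x3) * det3 1 3 5 x y z
  + x4 * det3 1 3 6 x y z + a1 * det3 1 4 5 x y z - x3 * det3 1 4 6 x y z
  - v1 * det3 1 5 6 x y z - (a1 + x4) * det3 2 3 5 x y z
  + a2 * det3 2 4 5 x y z - v2 * det3 2 5 6 x y z + 2 * p * det3 3 4 5 x y z
  - v3 * det3 3 5 6 x y z - v4 * det3 4 5 6 x y z.
Proof. by rewrite /torsion /wdot /det3 !row6E /wedge !J0E; ring. Qed.

Lemma frame_br_basis :
  (br (fb R 2) (fb R 3) = row6 0 0 0 0 0 0) *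
  (br (fb R 2) (fb R 4) = row6 0 0 0 0 0 0) *
  (br (fb R 2) (fb R 5) = row6 (- x2) 0 0 0 0 0) *
  (br (fb R 2) (fb R 6) = row6 0 (- x2) 0 0 0 0) *
  (br (fb R 3) (fb R 4) = row6 c 0 0 0 0 0) *
  (br (fb R 3) (fb R 5) = row6 (- x3) 0 0 0 0 0) *
  (br (fb R 3) (fb R 6) = row6 (- a1) (- a2) (- p) (- q) 0 0) *
  (br (fb R 4) (fb R 5) = row6 (- x4) 0 0 0 0 0) *
  (br (fb R 4) (fb R 6) = row6 (a2 - x3) (- (x4 + a1)) q (- p) 0 0) *
  (br (fb R 5) (fb R 6) = row6 (- v1) (- v2) (- v3) (- v4) (- m) 0) *
  (br (fb R 6) (fb R 2) = row6 0 x2 0 0 0 0) *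
  (br (fb R 6) (fb R 3) = row6 a1 a2 p q 0 0) *
  (br (fb R 6) (fb R 4) = row6 (x3 - a2) (x4 + a1) (- q) p 0 0).
Proof.
by do ![split]; rewrite !fb_row6 /frame_br ?wedge_row6 //=; coords; ring.
Qed.

End FrameTorsion.

(** The third hypothesis is the trace of D on n/n^1. The last two say in coordinates that n is not
    abelian and that g is not nilpotent. *)
Lemma frame_classification (c x2 x3 x4 a1 a2 p q m v1 v2 v3 v4 : R)
    (br := frame_br c x2 x3 x4 a1 a2 p q m v1 v2 v3 v4) :
  (forall x y z, br x (br y z) + br y (br z x) + br z (br x y) = 0) ->
  (forall x y z w, dtorsion br (@J0 R) (wdot 1) x y z w = 0) ->
  x2 + 2 * p + m = 0 ->
  ~ [/\ c = 0, x2 = 0, x3 = 0 & x4 = 0] ->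
  ~ (forall x y z w, br x (br y (br z w)) = 0) ->
  coord_iso br (phi_4_6 R) \/ coord_iso br (phi_4_7 R) \/
  coord_iso br (phi_6_25 R) \/
  (exists a, 0 < a /\ coord_iso br (phi_6_51 a)) \/
  coord_iso br (phi_6_158 R) \/
  (exists a, 0 < a /\ coord_iso br (phi_6_164 a)).
Proof.
move=> jac skt tr nonab nonnil.
have J256 : x2 * (m + x2) = 0.
  have /rowP/(_ (ix 1)) := jac (fb R 2) (fb R 5) (fb R 6).
  by rewrite /br !frame_br_basis !fb_row6 /frame_br !wedge_row6 //= !rowE => E; lra.
have J346 : c * p = 0.
  have /rowP/(_ (ix 1)) := jac (fb R 3) (fb R 4) (fb R 6).
  by rewrite /br !frame_br_basis !fb_row6 /frame_br !wedge_row6 //= !rowE => E; lra.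
have J356 : a2 * x2 - c * v4 + m * x3 + p * x3 + q * x4 = 0.
  have /rowP/(_ (ix 1)) := jac (fb R 3) (fb R 5) (fb R 6).
  by rewrite /br !frame_br_basis !fb_row6 /frame_br !wedge_row6 //= !rowE => E; lra.
have J456 : a1 * x2 + c * v3 + m * x4 + p * x4 - q * x3 + x2 * x4 = 0.
  have /rowP/(_ (ix 1)) := jac (fb R 4) (fb R 5) (fb R 6).
  by rewrite /br !frame_br_basis !fb_row6 /frame_br !wedge_row6 //= !rowE => E; lra.
have S2356 : a1 * m + a1 * p + 2 * a1 * x2 - a2 * q + m * x4 + p * x4 + 2 * x2 * x4 = 0.
  have := skt (fb R 2) (fb R 3) (fb R 5) (fb R 6).
  rewrite /br /dtorsion !frame_torsionE !frame_br_basis /det3 !fb_row6 !rowE => E.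
  by lra.
have S2456 : - a1 * q - a2 * m - a2 * p - 2 * a2 * x2 - q * x4 = 0.
  have := skt (fb R 2) (fb R 4) (fb R 5) (fb R 6).
  rewrite /br /dtorsion !frame_torsionE !frame_br_basis /det3 !fb_row6 !rowE => E.
  by lra.
have S3456 : a1 ^+ 2 + a1 * x4 + a2 ^+ 2 - a2 * x3 + c * v1 + m * p + 2 * p ^+ 2
    + x3 ^+ 2 + x4 ^+ 2 = 0.
  have := skt (fb R 3) (fb R 4) (fb R 5) (fb R 6).
  rewrite /br /dtorsion !frame_torsionE !frame_br_basis /det3 !fb_row6 !rowE => E.
  by lra.
have [p0 mE] : p = 0 /\ m = - x2.
  have [x20|x20] := eqVneq x2 0; last first.
    move: J256 => /eqP; rewrite mulf_eq0 (negPf x20) /= addr_eq0 => /eqP mE.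
    by split=> //; lra.
  have [c0|c0] := eqVneq c 0; last first.
    by move: J346 => /eqP; rewrite mulf_eq0 (negPf c0) /= => /eqP p0; split=> //; lra.
  (* When c = x2 = 0, the two Jacobi identities become (x3 + i x4)(p + i q) = 0, and (x3, x4) is
     nonzero because n is not abelian. *)
  have mp : m = - (2 * p) by lra.
  rewrite x20 c0 mp in J356 J456.
  have [|||p0 q0] := @sum_sqr_eq0 x3 x4 p q; last by rewrite mp p0 x20; split; ring.
  - by case=> x30 x40; apply: nonab.
  - lra.
  - lra.
have x2q : ~ (x2 = 0 /\ q = 0).
  case=> x20 q0; apply: nonnil => x y z w.
  (* If x2 = q = 0, every bracket lies in the span of e1, ..., e4, a further bracket lies in the
     span of e1 and e2, and this span is central. *)
  have step1 (u v : 'rV[R]_6) : br u v 0 (ix 5) = 0 /\ br u v 0 (ix 6) = 0.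
    by rewrite /br /frame_br !rowE mE x20 oppr0 mul0r.
  have step2 (u v : 'rV[R]_6) : v 0 (ix 5) = 0 -> v 0 (ix 6) = 0 ->
      br u v 0 (ix 3) = 0 /\ br u v 0 (ix 4) = 0.
    by move=> v5 v6; rewrite /br /frame_br /wedge !rowE p0 q0 v5 v6; split; ring.
  have step3 (u v : 'rV[R]_6) : v 0 (ix 3) = 0 -> v 0 (ix 4) = 0 -> v 0 (ix 5) = 0 ->
      v 0 (ix 6) = 0 -> br u v = 0.
    move=> v3_0 v4_0 v5_0 v6_0; rewrite /br /frame_br /wedge p0 q0 mE x20.
    by rewrite v3_0 v4_0 v5_0 v6_0; coords; ring.
  have [zw5 zw6] := step1 z w; have [yzw5 yzw6] := step1 y (br z w).
  by have [yzw3 yzw4] := step2 y _ zw5 zw6; apply: step3.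
rewrite p0 mE in J356 J456 S2356 S2456 S3456.
(* The SKT equations at (e2, e3, e5, e6) and (e2, e4, e5, e6) are the two parts of (x2 + i q)(a1 +
   x4 + i a2) = 0. *)
have [a1E a2E] : a1 + x4 = 0 /\ a2 = 0 by apply: (sum_sqr_eq0 x2q); lra.
have {}a1E : a1 = - x4 by lra.
rewrite a1E a2E in J356 J456 S3456.
rewrite /br a1E a2E p0 mE {br jac skt nonnil}.
have c1 : c * v1 = - (x3 ^+ 2 + x4 ^+ 2) by lra.
have c3 : c * v3 = q * x3 + x2 * x4 by lra.
have c4 : c * v4 = q * x4 - x2 * x3 by lra.
have [c0|c0] := eqVneq c 0.
  have x20 : x2 != 0.
    (* For c = x2 = 0 the identities [c3] and [c4] read q x3 = q x4 = 0, which would make n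
       abelian. *)
    apply/eqP => x20; have q0 : q != 0 by apply/eqP => q0; apply: x2q.
    rewrite c0 x20 !mul0r in c3 c4; apply: nonab; split=> //; apply: (mulfI q0); lra.
  have [x30 x40] : x3 = 0 /\ x4 = 0.
    rewrite c0 !mul0r in c3 c4.
    have [|||x30 x40] := @sum_sqr_eq0 q x2 x3 (- x4); last by split=> //; lra.
    - by case=> _ /eqP; rewrite (negPf x20).
    - by lra.
    - by lra.
  rewrite c0 x30 x40 oppr0.
  have [q0|q0] := eqVneq q 0; first by left; apply: case_s4_6.
  by right; right; right; left; apply: case_s6_51.
have [x20|x20] := eqVneq x2 0; last first.
  have [q0|q0] := eqVneq q 0.
    by right; right; right; right; left; apply: case_s6_158.
  by right; right; right; right; right; apply: case_s6_164.
have q0 : q != 0 by apply/eqP => q0; apply: x2q.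
have [v20|v20] := eqVneq v2 0; first by right; left; apply: case_s4_7.
by right; right; left; apply: case_s6_25.
Qed.

End Classification.

(** * A unitary basis adapted to the nilradical *)

Section Orthogonal.
Variables (R : realType) (g : lieAlgebra R) (met : g -> g -> R).
Hypothesis met_inner : is_inner_product met.

Lemma met_linear x : linear (met x : g -> R^o). Proof. by case: met_inner. Qed.
HB.instance Definition _ x := GRing.isLinear.Build R g R^o *:%R (met x) (met_linear x).

Definition met_form x : {linear g -> R^o} := met x.

(** Each vector of s cuts the subspace by the kernel of one linear form, which costs at most one
    dimension. *)
Lemma exists_orthogonal (s : seq g) (U : {vspace g}) : (size s < \dim U)%N ->
  exists u, [/\ u \in U, u != 0 & forall w, w \in s -> met w u = 0].
Proof.
elim: s U => [|w s IHs] U ltsU /=.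
  by exists (vpick U); rewrite memv_pick vpick0 -dimv_eq0 -lt0n.
have [|u [Uu u0 su]] := IHs (U :&: lker (linfun (met_form w)))%VS.
  have := limg_ker_dim (linfun (met_form w)) U.
  have := dimvS (subvf (linfun (met_form w) @: U)); rewrite dimvf /dim /= => le1 eqU.
  by rewrite -ltnS (leq_trans ltsU) // -eqU -addn1 leq_add2l.
exists u; move: Uu; rewrite memv_cap memv_ker lfunE => /andP[Uu /eqP wu].
by split=> // v; rewrite inE => /predU1P[->|/su].
Qed.

Lemma exists_unit_orthogonal (s : seq g) (U : {vspace g}) : (size s < \dim U)%N ->
  exists u, [/\ u \in U, met u u = 1 & forall w, w \in s -> met w u = 0].
Proof.
move=> /exists_orthogonal[u [Uu u0 su]].
have uu : 0 < met u u by case: met_inner => _ _; apply.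
exists ((Num.sqrt (met u u))^-1 *: u); split; first by rewrite memvZ.
  rewrite (metZl met_inner) (metZr met_inner) mulrA -invfM -expr2 sqr_sqrtr ?ltW //.
  by rewrite mulVf // gt_eqF.
by move=> w sw; rewrite (metZr met_inner) (su w sw) mulr0.
Qed.

End Orthogonal.

Section Frame.
Variables (R : realType) (g : lieAlgebra R) (J : 'End(g)) (met : g -> g -> R).
Variable n : {vspace g}.
Hypothesis dim_g : \dim {: g} = 6%N.
Hypothesis dim_n : \dim n = 5%N.
Hypothesis herm : is_hermitian J met.
Hypothesis dim_n1 : \dim (lcs n 1) = 1%N.
Hypothesis idn : is_ideal n.
Hypothesis Jn1 : (J @: lcs n 1 <= n)%VS.

Let inner : is_inner_product met. Proof. by case: herm. Qed.
Let JJ x : J (J x) = - x. Proof. by case: herm => -[]. Qed.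
Let metJ x y : met (J x) (J y) = met x y. Proof. by case: herm. Qed.
Let metE := (metDl inner, metDr inner, metZl inner, metZr inner,
  metNl inner, metNr inner).
Let metC' := metC inner.

Let metJl x y : met (J x) y = - met x (J y).
Proof. by rewrite -[in RHS]metJ JJ (metNr inner) opprK. Qed.

(** Take a unit vector a in n^1 and a unit normal d of n. The J-invariant planes of a and d are
    orthogonal, and any unit vector b orthogonal to both planes supplies the third. *)
Lemma adapted_frame : exists (psi : 'Hom('rV[R]_6, g)) (chi : 'Hom(g, 'rV[R]_6)),
  [/\ cancel psi chi, cancel chi psi,
      (forall x y, met (psi x) (psi y) = wdot 1 x y) /\
      (forall x, J (psi x) = psi (J0 x)),
      forall x, (psi x \in n) = (x 0 (ix 6) == 0)
    & psi (fb R 1) \in lcs n 1].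
Proof.
have [|a [l1a aa _]] := exists_unit_orthogonal inner (s := [::]) (U := lcs n 1).
  by rewrite dim_n1.
have na : a \in n by apply: (subvP (lcs_sub 0 idn)).
have nJa : J a \in n by apply: (subvP Jn1); rewrite memv_img.
have [|d [_ dd nd]] := exists_unit_orthogonal inner (s := vbasis n) (U := fullv).
  by rewrite size_tuple dim_n dim_g.
have nd' u : u \in n -> met d u = 0.
  move=> /coord_vbasis ->; rewrite -[met d]/(met_form inner d : g -> R^o).
  rewrite linear_sum big1 // => i _.
  by rewrite linearZ /= metC' nd ?mulr0 ?mem_nth ?size_tuple // scaler0.
(* The sign makes d = J c, so that the last basis vector e6 is the normal itself. *)
pose c := - J d.
have Jc : J c = d by rewrite linearN /= JJ opprK.
have nE u : (u \in n) = (met d u == 0).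
  have -> : n = lker (linfun (met_form inner d)).
    apply/eqP; rewrite eqEdim; apply/andP; split.
      by apply/subvP => v /nd' dv; rewrite memv_ker lfunE /= dv.
    have := limg_ker_dim (linfun (met_form inner d)) fullv.
    rewrite capfv dim_g dim_n => E; rewrite -ltnS -{}E -addn1 leq_add2l lt0n dimv_eq0.
    apply/eqP => E; have : linfun (met_form inner d) d \in limg (linfun (met_form inner d)).
      by rewrite memv_img ?memvf.
    by rewrite E memv0 lfunE /= dd oner_eq0.
  by rewrite memv_ker lfunE.
have [|b [_ bb sb]] := exists_unit_orthogonal inner (s := [:: a; J a; c; J c]) (U := fullv).
  by rewrite dim_g.
have ab : met a b = 0 by rewrite sb ?inE ?eqxx.
have aJb : met a (J b) = 0 by apply/oppr_inj; rewrite -metJl oppr0 sb ?inE ?eqxx ?orbT.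
have cb : met c b = 0 by rewrite sb ?inE ?eqxx ?orbT.
have cJb : met c (J b) = 0 by apply/oppr_inj; rewrite -metJl oppr0 sb ?inE ?eqxx ?orbT.
(* This is where J n^1 in n is used: up to sign, the product of a and J d is that of J a and d. *)
have ac : met a c = 0 by rewrite /c metE -metJl metC' nd'.
have aJc : met a (J c) = 0 by rewrite Jc metC' nd'.
have bJc : met b (J c) = 0 by rewrite -[LHS]opprK -metJl metC' cJb oppr0.
have cc : met c c = 1 by rewrite /c !metE metJ opprK.
have self u : met u (J u) = 0.
  have := metJl u u; rewrite metC' => /eqP; rewrite -addr_eq0 -mulr2n mulrn_eq0 /=.
  by move/eqP.
clearbody c.
have ba : met b a = 0 by rewrite metC'.
have bc : met b c = 0 by rewrite metC'.
have ca : met c a = 0 by rewrite metC'.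
have bJa : met b (J a) = 0 by rewrite -[LHS]opprK -metJl metC' aJb oppr0.
have cJa : met c (J a) = 0 by rewrite -[LHS]opprK -metJl metC' aJc oppr0.
pose L (x : 'rV[R]_6) := (x 0 (ix 1) *: a + x 0 (ix 2) *: J a)
  + (x 0 (ix 3) *: b + x 0 (ix 4) *: J b)
  + (x 0 (ix 5) *: c + x 0 (ix 6) *: J c).
have Llin : linear L.
  move=> t x y; rewrite /L !rowE !scalerDl !scalerDr !scalerA.
  by rewrite [LHS](AC ((2*2)*(2*2)*(2*2)) ((1*3*(5*7)*(9*11))*((2*4)*(6*8)*(10*12)))).
pose H := GRing.isLinear.Build _ _ _ _ L Llin.
pose P : {linear 'rV[R]_6 -> g} := HB.pack L H.
pose psi := linfun P.
have psiE x : psi x = L x by rewrite lfunE.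
have psi_met x y : met (psi x) (psi y) = wdot 1 x y.
  rewrite !psiE /L !metE !metJl !JJ !metE !self.
  rewrite aa ab aJb ac aJc ba bJa bb bc bJc ca cJa cb cJb cc /wdot.
  ring.
have psiJ x : J (psi x) = psi (J0 x).
  rewrite !psiE /L !linearD !linearZ /= !JJ /J0 !rowE !scalerN !scaleNr.
  by congr (_ + _ + _); rewrite addrC.
(* A linear map that pulls the metric back to a positive definite form is injective; surjectivity
   follows by dimension. *)
have psi_inj : lker psi == 0%VS.
  rewrite -subv0; apply/subvP => x; rewrite memv_ker memv0 => /eqP x0.
  apply/negPn/negP => xn0.
  have [_ _ /(_ x xn0)] := wdot_inner (@ltr01 R).
  by rewrite -psi_met x0 -[met 0]/(met_form inner 0 : g -> R^o) linear0 ltxx.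
have psi_surj : limg psi = fullv.
  apply/eqP; rewrite eqEdim subvf dim_g limg_dim_eq ?(eqP psi_inj) ?capv0 //.
  by rewrite dimvf /dim /=.
exists psi, (psi^-1)%VF; split.
- exact: lker0_lfunK.
- by move=> u; rewrite limg_lfunVK // psi_surj memvf.
- by split.
- move=> x; have psi6 : psi (fb R 6) = d.
    by rewrite psiE /L fb6 !rowE !scale0r scale1r !add0r Jc.
  rewrite nE -psi6 psi_met /wdot fb6 !rowE; congr (_ == 0); ring.
by rewrite psiE /L fb1 !rowE !scale0r scale1r !addr0.
Qed.

End Frame.

(** * The shape of the bracket forced by integrability *)

Section Structure.
Variable R : realType.
Variable br : 'rV[R]_6 -> 'rV[R]_6 -> 'rV[R]_6.
Implicit Types x y z : 'rV[R]_6.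
Hypotheses (br_linr : forall x, linear (br x)) (br_linl : forall y, linear (br^~ y)).
Hypothesis br_xx : forall x, br x x = 0.
Hypothesis br1 : forall x, br x (fb R 1) = 0.
Hypothesis br_n : forall x y, x 0 (ix 6) = 0 -> y 0 (ix 6) = 0 ->
  exists t, br x y = t *: fb R 1.
Hypothesis br_id : forall x y, y 0 (ix 6) = 0 -> br x y 0 (ix 6) = 0.
Hypothesis nij : forall x y,
  br (J0 x) (J0 y) - J0 (br (J0 x) y) - J0 (br x (J0 y)) - br x y = 0.

Let brDr x y z : br x (y + z) = br x y + br x z.
Proof. by have := br_linr x 1 y z; rewrite !scale1r. Qed.
Let brDl x y z : br (x + y) z = br x z + br y z.
Proof. by have := br_linl z 1 x y; rewrite !scale1r. Qed.
Let br0r x : br x 0 = 0.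
Proof. by apply: (addrI (br x 0)); rewrite -brDr !addr0. Qed.
Let br0l x : br 0 x = 0.
Proof. by apply: (addrI (br 0 x)); rewrite -brDl !addr0. Qed.
Let brZr x a y : br x (a *: y) = a *: br x y.
Proof. by have := br_linr x a y 0; rewrite br0r !addr0. Qed.
Let brZl x a y : br (a *: x) y = a *: br x y.
Proof. by have := br_linl y a x 0; rewrite br0l !addr0. Qed.
Let brC x y : br y x = - br x y.
Proof.
apply/eqP; rewrite -addr_eq0; apply/eqP.
by have := br_xx (x + y); rewrite brDl !brDr !br_xx add0r addr0 addrC.
Qed.

Let row6_sum (x : 'rV[R]_6) : x = x 0 (ix 1) *: fb R 1 + x 0 (ix 2) *: fb R 2
  + x 0 (ix 3) *: fb R 3 + x 0 (ix 4) *: fb R 4 + x 0 (ix 5) *: fb R 5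
  + x 0 (ix 6) *: fb R 6.
Proof. by rewrite !fb_row6; apply: row6P; rewrite !rowE; ring. Qed.

(** The bracket starts with 26 unknowns: six brackets within n, all multiples of e1, and five
    coefficients for each of D e2, ..., D e5. Since N(J x, y) = - J N(x, y), integrability is tested
    on one vector from each complex line: (e1, e3), (e1, e5) and (e3, e5). This gives the 13
    relations [n1] to [n13] and leaves 13 parameters. *)
Lemma frame_structure : exists c x2 x3 x4 a1 a2 p q m v1 v2 v3 v4 : R,
  forall x y,
  br x y = frame_br c x2 x3 x4 a1 a2 p q m v1 v2 v3 v4 x y.
Proof.
have J1 : J0 (fb R 1) = fb R 2 by rewrite /J0 !fb_row6; coords; rewrite ?oppr0.
have J3 : J0 (fb R 3) = fb R 4 by rewrite /J0 !fb_row6; coords; rewrite ?oppr0.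
have J5 : J0 (fb R 5) = fb R 6 by rewrite /J0 !fb_row6; coords; rewrite ?oppr0.
have f6 k : (0 < k < 6)%N -> fb R k 0 (ix 6) = 0.
  by case: k => [|[|[|[|[|[|k]]]]]] // _; rewrite ?fb_row6 !rowE.
have [t23 b23] := br_n (f6 2%N isT) (f6 3%N isT).
have [t24 b24] := br_n (f6 2%N isT) (f6 4%N isT).
have [t25 b25] := br_n (f6 2%N isT) (f6 5%N isT).
have [t34 b34] := br_n (f6 3%N isT) (f6 4%N isT).
have [t35 b35] := br_n (f6 3%N isT) (f6 5%N isT).
have [t45 b45] := br_n (f6 4%N isT) (f6 5%N isT).
have b6 k : (0 < k < 6)%N ->
    exists d1 d2 d3 d4 d5, br (fb R 6) (fb R k) = row6 d1 d2 d3 d4 d5 0.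
  move=> /f6/(br_id (fb R 6)) E; rewrite [br _ _]row6_eta E.
  by do 5!eexists.
have [d12 [d22 [d32 [d42 [d52 b62]]]]] := b6 2%N isT.
have [d13 [d23 [d33 [d43 [d53 b63]]]]] := b6 3%N isT.
have [d14 [d24 [d34 [d44 [d54 b64]]]]] := b6 4%N isT.
have [d15 [d25 [d35 [d45 [d55 b65]]]]] := b6 5%N isT.
have br1' x : br (fb R 1) x = 0 by rewrite brC br1 oppr0.
have N13 := nij (fb R 1) (fb R 3).
have N15 := nij (fb R 1) (fb R 5).
have N35 := nij (fb R 3) (fb R 5).
rewrite J1 J3 br1' b24 b23 br1' !fb_row6 /J0 in N13.
rewrite J1 J5 !br1' (brC (fb R 6)) b25 b62 !fb_row6 /J0 in N15.
rewrite J3 J5 (brC (fb R 6)) b45 b64 (brC (fb R 6) (fb R 3)) b63 b35 !fb_row6 /J0 in N35.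
have [n1 n2] : t24 = 0 /\ t23 = 0.
  have /rowP/(_ (ix 1)) := N13; have /rowP/(_ (ix 2)) := N13; rewrite !rowE => E1 E2.
  by split; lra.
have [n3 n4 n5 n6 n7] : [/\ d12 = 0, d22 = - t25, d32 = 0, d42 = 0 & d52 = 0].
  move: N15 => /rowP N; move: (N (ix 1)) (N (ix 2)) (N (ix 3)) (N (ix 4)) (N (ix 5)).
  rewrite !rowE => E1 E2 E3 E4 E5.
  by split; lra.
have [n8 n9 n10] : [/\ d53 = 0, d54 = 0 & d14 = - d23 - t35].
  move: N35 => /rowP N; move: (N (ix 1)) (N (ix 5)) (N (ix 6)).
  by rewrite !rowE => E1 E2 E3; split; lra.
have [n11 n12 n13] : [/\ d24 = d13 - t45, d34 = - d43 & d44 = d33].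
  move: N35 => /rowP N; move: (N (ix 2)) (N (ix 3)) (N (ix 4)).
  by rewrite !rowE => E1 E2 E3; split; lra.
exists t34, (- t25), (- t35), (- t45), d13, d23, d33, d43, d55, d15, d25, d35, d45.
move=> x y; rewrite {1}(row6_sum x) {1}(row6_sum y).
rewrite !brDl !brZl !brDr !brZr !br_xx !br1 !br1'.
rewrite !(brC (fb R 2) (fb R 3), brC (fb R 2) (fb R 4), brC (fb R 2) (fb R 5)).
rewrite !(brC (fb R 3) (fb R 4), brC (fb R 3) (fb R 5), brC (fb R 4) (fb R 5)).
rewrite !(brC (fb R 6) (fb R 2), brC (fb R 6) (fb R 3)).
rewrite !(brC (fb R 6) (fb R 4), brC (fb R 6) (fb R 5)).
rewrite b23 b24 b25 b34 b35 b45 b62 b63 b64 b65 n1 n2 n3 n4 n5 n6 n7 n8 n9 n10 n11 n12 n13.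
rewrite !(scaler0, scale0r, oppr0, addr0, add0r) !fb_row6.
by apply: row6P; rewrite !rowE /wedge; ring.
Qed.

End Structure.

Lemma coord_iso_lie_isomorphic (R : realType) (g : lieAlgebra R)
    (psi : 'Hom('rV[R]_6, g)) (chi : 'Hom(g, 'rV[R]_6)) br phi
    (laws : str_lie_laws phi) :
  cancel psi chi -> cancel chi psi ->
  (forall x y, bracket (psi x) (psi y) = psi (br x y)) ->
  coord_iso br phi -> lie_isomorphic g (str_lie laws).
Proof.
move=> psiK chiK psi_br [th [th' [th_lin thK th_br]]].
have [T TE] := linear_lfun th_lin.
have kerT : lker T == 0%VS by apply/lker0P => x y; rewrite !TE => /(can_inj thK).
have surjT : limg T = fullv.
  by apply/eqP; rewrite eqEdim subvf limg_dim_eq ?(eqP kerT) ?capv0 ?leqnn.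
apply: lie_isomorphic_sym.
exists (psi \o T : str_lie laws -> g).
  exists ((T^-1)%VF \o chi) => [x|u] /=; first by rewrite psiK lker0_lfunK.
  by rewrite limg_lfunVK ?surjT ?memvf.
by move=> x y /=; rewrite psi_br !TE th_br.
Qed.

(** * The classification and the theorem *)

Section Classify.
Variables (R : realType) (g : lieAlgebra R) (n : {vspace g}).
Hypotheses (dim_g : \dim {: g} = 6%N) (nr : is_nilradical n).
Hypotheses (an : almost_nilpotent g) (su : strongly_unimodular g).
Hypothesis dim_n1 : \dim (lcs n 1) = 1%N.

Lemma SKT_classification :
  (exists (J : 'End(g)) (met : g -> g -> R),
     is_SKT J met /\ (J @: lcs n 1 <= n)%VS) ->
  lie_isomorphic g (s4_6_R2 R) \/
  lie_isomorphic g (s4_7_R2 R) \/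
  lie_isomorphic g (s6_25 R) \/
  (exists a : R, 0 < a /\ lie_isomorphic g (s6_51 a)) \/
  lie_isomorphic g (s6_158 R) \/
  (exists a : R, 0 < a /\ lie_isomorphic g (s6_164 a)).
Proof.
move=> [J [met [/is_SKTP[herm skt] Jn1]]].
have [idn niln maxn] := nr.
have dim_n : \dim n = 5%N.
  have [_ [n' nr']] := an; rewrite dim_g (nilradical_unique nr' nr) => -[].
  by move=> ->.
have tr x l : quo_trace (bracket x) (lcs n l) (lcs n l.+1) = 0.
  by have [_ [n' nr' trn]] := su; rewrite (nilradical_unique nr nr').
have inner : is_inner_product met by case: herm.
have [[JJ nijJ] _ metJ] := herm.
have [psi [chi [psiK chiK [psi_met psi_J] psi_n psi_n1]]] :=
  adapted_frame dim_g dim_n herm dim_n1 idn Jn1.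
pose br x y := chi (bracket (psi x) (psi y)).
have psi_br x y : bracket (psi x) (psi y) = psi (br x y) by rewrite /br chiK.
set a := psi (fb R 1) in psi_n1.
have wdot_fb k x : (0 < k <= 6)%N -> wdot 1 (fb R k) x = x 0 (ix k).
  by case: k => [|[|[|[|[|[|[|k]]]]]]] // _; rewrite /wdot !fb_row6 !rowE; ring.
have aa : met a a = 1 by rewrite psi_met wdot_fb // fb1 rowE.
have n1E : lcs n 1 = <[a]>%VS.
  apply/esym/eqP; rewrite eqEdim dim_n1 dim_vline -memvE psi_n1 /=.
  suff -> : a != 0 by [].
  apply/eqP => a0; have := aa; rewrite a0 (met0r inner) => /eqP.
  by rewrite eq_sym oner_eq0.
have dim_n2 : lcs n 2 = 0%VS by apply: lcs2_eq0.
pose fm := met_form inner.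
have fmE v u : fm v u = met v u by [].
(* ad x acts on the line n^1 by a scalar, which is its trace on n^1 / [n, n^1] = n^1. *)
have br1 x : br x (fb R 1) = 0.
  have ux : bracket (psi x) a \in lcs n 1 by apply: idealP (lcs1_ideal idn) _ _ psi_n1.
  have := tr (psi x) 1%N.
  rewrite dim_n2 (@quo_traceE _ _ _ _ _ 1 (fun=> a) (fun=> fm a)) ?sub0v //.
  - rewrite big_ord1 /=; move: ux; rewrite n1E => /vlineP[t E].
    rewrite /br -/a E (metZr inner) aa mulr1 => ->.
    by rewrite scale0r linear0.
  - by move=> v; rewrite memv0 => /eqP ->; rewrite linear0 mem0v.
  - by move=> v; apply: idealP (lcs1_ideal idn) _ _.
  - by move=> _ v; rewrite memv0 => /eqP ->; rewrite linear0.
  - move=> v; rewrite n1E => /vlineP[t ->].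
    by rewrite big_ord1 /= ?fmE (metZr inner) aa mulr1 subrr mem0v.
have br_n (x y : 'rV[R]_6) : x 0 (ix 6) = 0 -> y 0 (ix 6) = 0 ->
    exists t, br x y = t *: fb R 1.
  move=> /eqP x6 /eqP y6.
  have : bracket (psi x) (psi y) \in lcs n 1 by rewrite mem_lie_prod ?psi_n.
  by rewrite n1E => /vlineP[t E]; exists t; rewrite /br E linearZ /= psiK.
have br_id (x y : 'rV[R]_6) : y 0 (ix 6) = 0 -> br x y 0 (ix 6) = 0.
  by move=> /eqP y6; apply/eqP; rewrite -psi_n -psi_br; apply: idealP => //; rewrite psi_n.
have nij x y : br (J0 x) (J0 y) - J0 (br (J0 x) y) - J0 (br x (J0 y)) - br x y = 0.
  apply: (can_inj psiK); rewrite linear0 !linearB /=.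
  by rewrite -(nijJ (psi x) (psi y)) /nijenhuis !psi_J !psi_br !psi_J.
have br_linr x : linear (br x).
  by move=> t y z; rewrite /br !linearP.
have br_linl y : linear (br^~ y).
  by move=> t x z; rewrite /br linearP bracketDl bracketZl linearP.
have br_xx x : br x x = 0 by rewrite /br bracketxx linear0.
have [c [x2 [x3 [x4 [a1 [a2 [p [q [m [v1 [v2 [v3 [v4 brE]]]]]]]]]]]]] :=
  frame_structure br_linr br_linl br_xx br1 br_n br_id nij.
pose br' := frame_br c x2 x3 x4 a1 a2 p q m v1 v2 v3 v4.
have psi_br' x y : bracket (psi x) (psi y) = psi (br' x y) by rewrite psi_br brE.
have jac x y z : br' x (br' y z) + br' y (br' z x) + br' z (br' x y) = 0.
  by apply: (can_inj psiK); rewrite linear0 !linearD /= -!psi_br' bracket_jacobi.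
have skt' x y z w : dtorsion br' (@J0 R) (wdot 1) x y z w = 0.
  rewrite -(skt (psi x) (psi y) (psi z) (psi w)) /dtorsion /torsion.
  by rewrite !psi_br' !psi_J !psi_br' !psi_met.
(* This is the case l = 0: e2, ..., e5 represent a basis of n/n^1, where D has diagonal x2, p, p,
   m. *)
have trace : x2 + 2 * p + m = 0.
  have := tr (psi (fb R 6)) 0%N.
  rewrite (@quo_traceE _ _ _ _ _ 4 (fun j => psi (fb R j.+2))
    (fun j => fm (psi (fb R j.+2)))).
  - rewrite !big_ord_recl big_ord0 /= ?fmE !psi_br' !psi_met !wdot_fb //=.
    by rewrite /br' /frame_br /wedge !fb_row6 !rowE => E; lra.
  - exact: lcs_sub 0 idn.
  - by move=> v; apply: idealP (lcs1_ideal idn) _ _.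
  - by move=> v; apply: idealP idn _ _.
  - by move=> j; rewrite psi_n; case: j => -[|[|[|[|j]]]] //= _; rewrite !fb_row6 !rowE.
  - move=> j v; rewrite n1E => /vlineP[t ->]; rewrite linearZ /= ?fmE psi_met.
    rewrite wdot_fb; last by case: j => -[|[|[|[|j]]]].
    by case: j => -[|[|[|[|j]]]] //= _; rewrite !fb_row6 !rowE ?scaler0 ?mulr0.
  - move=> v; rewrite -[v]chiK psi_n; set y := chi v => /eqP y6.
    rewrite !big_ord_recl big_ord0 /= ?fmE !psi_met !wdot_fb //.
    have E : y - (y 0 (ix 2) *: fb R 2 + (y 0 (ix 3) *: fb R 3
        + (y 0 (ix 4) *: fb R 4 + (y 0 (ix 5) *: fb R 5 + 0)))) = y 0 (ix 1) *: fb R 1.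
      by rewrite !fb_row6; apply: row6P; rewrite !rowE ?y6; ring.
    have := congr1 psi E; rewrite linearB !linearD !linearZ linear0 /= => ->.
    by rewrite memvZ.
have nonab : ~ [/\ c = 0, x2 = 0, x3 = 0 & x4 = 0].
  case=> c0 x20 x30 x40; suff /dimvS : (lcs n 1 <= 0)%VS by rewrite dim_n1 dimv0.
  apply/lie_prod_subP => u v; rewrite -[u]chiK -[v]chiK !psi_n psi_br'.
  move: (chi u) (chi v) => x y /eqP x6 /eqP y6.
  rewrite /br' /frame_br /wedge c0 x20 x30 x40 x6 y6 memv0 -(linear0 psi); apply/eqP.
  by congr (psi _); coords; ring.
(* Otherwise g would be a nilpotent ideal of itself, hence contained in n, which has dimension 5. *)
have nonnil : ~ (forall x y z w, br' x (br' y (br' z w)) = 0).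
  move=> br0; have idg : is_ideal (fullv : {vspace g}) by apply: subvf.
  have nilg : nilpotent_sub (fullv : {vspace g}).
    apply: nilpotent_of_bracket4 => x y z w.
    by rewrite -[x]chiK -[y]chiK -[z]chiK -[w]chiK !psi_br' br0 linear0.
  by have := dimvS (maxn _ idg nilg); rewrite dim_g dim_n.
have iso phi (laws : str_lie_laws phi) : coord_iso br' phi -> lie_isomorphic g (str_lie laws).
  exact: coord_iso_lie_isomorphic psiK chiK psi_br'.
have := frame_classification jac skt' trace nonab nonnil.
case=> [/iso i|]; first by left; apply: i.
case=> [/iso i|]; first by right; left; apply: i.
case=> [/iso i|]; first by right; right; left; apply: i.
case=> [[b [b0 /iso i]]|]; first by right; right; right; left; exists b; split=> //; apply: i.
case=> [/iso i|]; first by right; right; right; right; left; apply: i.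
by case=> b [b0 /iso i]; right; right; right; right; right; exists b; split=> //; apply: i.
Qed.
End Classify.

Theorem theorem4p15 (R : realType) :
  (forall (g : lieAlgebra R) (n : {vspace g}),
     \dim {: g} = 6%N -> almost_nilpotent g -> strongly_unimodular g ->
     is_nilradical n -> \dim (lcs n 1) = 1%N ->
     ((exists (J : 'End(g)) (met : g -> g -> R),
         is_SKT J met /\ (J @: lcs n 1 <= n)%VS)
      <->
      (lie_isomorphic g (s4_6_R2 R) \/
       lie_isomorphic g (s4_7_R2 R) \/
       lie_isomorphic g (s6_25 R) \/
       (exists a : R, 0 < a /\ lie_isomorphic g (s6_51 a)) \/
       lie_isomorphic g (s6_158 R) \/
       (exists a : R, 0 < a /\ lie_isomorphic g (s6_164 a))))) /\
  (exists (J : 'End(s4_6_R2 R)) (met : s4_6_R2 R -> s4_6_R2 R -> R),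
     [/\ J (fb R 1) = fb R 2, J (fb R 3) = fb R 6, J (fb R 4) = fb R 5,
         orthonormal_seq met
           [:: fb R 1; fb R 2; fb R 3; fb R 4; fb R 5; fb R 6]
       & is_SKT_adapted J met]) /\
  (exists (J : 'End(s4_7_R2 R)) (met : s4_7_R2 R -> s4_7_R2 R -> R),
     [/\ J (fb R 1) = fb R 4, J (fb R 2) = fb R 3, J (fb R 5) = fb R 6,
         orthonormal_seq met
           [:: fb R 1; fb R 2; fb R 3; fb R 4; fb R 5; fb R 6]
       & is_SKT_adapted J met]) /\
  (exists (J : 'End(s6_25 R)) (met : s6_25 R -> s6_25 R -> R),
     [/\ J (fb R 1) = - fb R 5, J (fb R 2) = fb R 3, J (fb R 4) = fb R 6,
         orthonormal_seq met
           [:: fb R 1; fb R 2; fb R 3; fb R 4; fb R 5; fb R 6]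
       & is_SKT_adapted J met]) /\
  (forall a : R, 0 < a ->
   exists (J : 'End(s6_51 a)) (met : s6_51 a -> s6_51 a -> R),
     [/\ J (fb R 1) = a *: fb R 2, J (fb R 3) = fb R 6, J (fb R 4) = fb R 5,
         orthonormal_seq met
           [:: fb R 1; a *: fb R 2; fb R 3; fb R 4; fb R 5; fb R 6]
       & is_SKT_adapted J met]) /\
  (exists (J : 'End(s6_158 R)) (met : s6_158 R -> s6_158 R -> R),
     [/\ J (fb R 1) = fb R 3, J (fb R 2) = fb R 4, J (fb R 5) = fb R 6,
         orthonormal_seq met
           [:: fb R 1; fb R 2; fb R 3; fb R 4; fb R 5; fb R 6]
       & is_SKT_adapted J met]) /\
  (forall a : R, 0 < a ->
   exists (J : 'End(s6_164 a)) (met : s6_164 a -> s6_164 a -> R),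
     [/\ J (fb R 1) = a *: fb R 2, J (fb R 3) = fb R 5, J (fb R 4) = fb R 6,
         orthonormal_seq met
           [:: fb R 1; a *: fb R 2; fb R 3; fb R 4; fb R 5; fb R 6]
       & is_SKT_adapted J met]).
Proof.
split; last first.
  split; first exact: s4_6_R2_SKT.
  split; first exact: s4_7_R2_SKT.
  split; first exact: s6_25_SKT.
  split; first by move=> a; apply: s6_51_SKT.
  split; first exact: s6_158_SKT.
  by move=> a; apply: s6_164_SKT.
move=> g n dim_g an su nr dim_n1; split; first exact: SKT_classification.
have tr h := @SKT_transport R g h n ^~ nr.
case=> [i|[i|[i|[[a [a0 i]]|[i|[a [a0 i]]]]]]]; apply: (tr _ i).
- by have [J [met [_ _ _ _ ?]]] := s4_6_R2_SKT R; exists J, met.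
- by have [J [met [_ _ _ _ ?]]] := s4_7_R2_SKT R; exists J, met.
- by have [J [met [_ _ _ _ ?]]] := s6_25_SKT R; exists J, met.
- by have [J [met [_ _ _ _ ?]]] := s6_51_SKT a0; exists J, met.
- by have [J [met [_ _ _ _ ?]]] := s6_158_SKT R; exists J, met.
- by have [J [met [_ _ _ _ ?]]] := s6_164_SKT a0; exists J, met.
Qed.
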